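(* Let $T\in\mathcal L(\mathcal P_n)$, $T\neq 0$. The following statements are equivalent: (a) $T\in\mathcal D(\mathcal P_n)$ and $T$ is invertible; (b) $T$ is a Grace operator; (c) $K_h(T)<+\infty$; (d) $K_m(T)<+\infty$; (e) $T$ is invertible and $TD=DT$; (f) $K_H(T)<+\infty$; (g) $\deg(Tf)=\deg(f)$ for all $f\in\mathcal P_n$, and $K_F(T)<+\infty$.
   Context: Let $n\ge 1$ be an integer and $\mathcal P_n$ the complex vector space of polynomials in one complex variable of degree at most $n$; $\mathcal L(\mathcal P_n)$ is the set of linear operators $\mathcal P_n\to\mathcal P_n$. Let $\phi_k(z)=z^k/k!$, $k=0,\dots,n$ (a basis of $\mathcal P_n$). $D$ denotes differentiation on $\mathcal P_n$, $I$ the identity, and $\mathcal D(\mathcal P_n)$ the linear span of $I,D,\dots,D^n$ in $\mathcal L(\mathcal P_n)$. For a nonzero $f\in\mathcal P_n$, $Z(f)$ denotes the multiset of roots of $f$ (each root listed according to its multiplicity, so $Z(f)$ has $\deg f$ elements and is empty for nonzero constants); $Z(0)=\mathbb C$. For $A,B\subset\mathbb C$, $A+B=\{u+v:u\in A,v\in B\}$. A circular domain is an open or closed disk, the open or closed exterior of a disk, or an open or closed half-plane in $\mathbb C$. An operator $T\in\mathcal L(\mathcal P_n)$ is a Grace operator if there is a finite set $A\subset\mathbb C$ such that $Z(Tf)\subset Z(f)+\Omega$ for all $f\in\mathcal P_n\setminus\{0\}$ and all circular domains $\Omega$ with $A\subset\Omega$. Distances: for finite nonempty $A,B\subset\mathbb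 C$, $d_m(A,B)=\min\{|x-y|:x\in A,y\in B\}$, $d_h(A,B)=\max_{y\in B}\min_{x\in A}|x-y|$, $d_H(A,B)=\max\{d_h(A,B),d_h(B,A)\}$. Conventions: for $d\in\{d_m,d_h,d_H\}$, $d(\emptyset,\emptyset)=0$, $d(A,\emptyset)=d(\emptyset,A)=+\infty$ for $A\ne\emptyset$, and $d(A,B)=0$ if one of $A,B$ equals $\mathbb C$ and the other is nonempty. For multisets $U=\{u_1,\dots,u_m\}$, $V=\{v_1,\dots,v_m\}$ of $m$ complex numbers, $d_F(U,V)=\min_{\sigma}\max_{1\le k\le m}|u_k-v_{\sigma(k)}|$, the minimum over permutations $\sigma$ of $\{1,\dots,m\}$. For $T\in\mathcal L(\mathcal P_n)$: $K_m(T)=\sup_{f\in\mathcal P_n}d_m(Z(f),Z(Tf))$, $K_h(T)=\sup_{f\in\mathcal P_n}d_h(Z(f),Z(Tf))$, $K_H(T)=\sup_{f\in\mathcal P_n}d_H(Z(f),Z(Tf))$; and, only for $T$ with $\deg(Tf)=\deg f$ for all $f\in\mathcal P_n$, $K_F(T)=\sup\{d_F(Z(f),Z(Tf)): f\in\mathcal P_n \text{ nonconstant}\}$. *)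

(* Defs.v *)
(* MathComp + mathcomp-real-closed (complex numbers R[i])
   + MathComp-Analysis (extended reals \bar R, ereal_sup). *)
From HB Require Import structures.
From mathcomp Require Import all_boot all_order all_algebra.
From mathcomp Require Import fingroup perm complex.
From mathcomp Require Import classical_sets reals constructive_ereal ereal.

Set Implicit Arguments.
Unset Strict Implicit.
Unset Printing Implicit Defensive.

Import Order.TTheory GRing.Theory Num.Theory.
Local Open Scope ring_scope.
Local Open Scope classical_set_scope.

Section Defs.
Variable R : realType.
Local Notation C := R[i].

(* real-valued modulus |z| of a complex number *)
Definition cnorm (z : C) : R := complex.Re `|z|.

(* P_n : polynomials of degree at most n *)
Definition inPn (n : nat) (f : {poly C}) : bool := (size f <= n.+1)%N.

(* An operator in L(P_n) is represented by a linear map on C[z] that maps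
   P_n into P_n; only its restriction to P_n matters below. *)
Definition maps_Pn (n : nat) (T : {poly C} -> {poly C}) : Prop :=
  forall f, inPn n f -> inPn n (T f).

(* T is (the restriction of) the zero operator on P_n *)
Definition op_nonzero (n : nat) (T : {poly C} -> {poly C}) : Prop :=
  exists2 f, inPn n f & T f != 0.

(* T is invertible as an operator on P_n *)
Definition op_invertible (n : nat) (T : {poly C} -> {poly C}) : Prop :=
  exists S : {poly C} -> {poly C},
    forall f, inPn n f -> [/\ inPn n (S f), S (T f) = f & T (S f) = f].

(* T belongs to D(P_n) = span(I, D, ..., D^n) *)
Definition in_diff_span (n : nat) (T : {poly C} -> {poly C}) : Prop :=
  exists c : 'I_n.+1 -> C,
    forall f, inPn n f -> T f = \sum_(k < n.+1) c k *: f^`(k).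

(* T D = D T on P_n *)
Definition commutes_with_D (n : nat) (T : {poly C} -> {poly C}) : Prop :=
  forall f, inPn n f -> T f^`() = (T f)^`().

(* Z(f) as a set: for f = 0 this is all of C *)
Definition Zset (f : {poly C}) : set C := [set z | root f z].

(* Minkowski sum A + B *)
Definition setsum (A B : set C) : set C :=
  [set w | exists u v, A u /\ B v /\ w = u + v].

(* circular domains: open/closed disks, open/closed exteriors of disks
   (positive radius), open/closed half-planes *)
Definition circular_domain (Om : set C) : Prop :=
  (exists (c : C) (r : R), 0 < r /\
     [\/ Om = [set z | cnorm (z - c) < r],
         Om = [set z | cnorm (z - c) <= r],
         Om = [set z | r < cnorm (z - c)] |
         Om = [set z | r <= cnorm (z - c)]]) \/
  (exists c u : C, u != 0 /\
     (Om = [set z | 0 < complex.Re ((z - c) * (u ^*)%C)] \/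
      Om = [set z | 0 <= complex.Re ((z - c) * (u ^*)%C)])).

(* Grace operator *)
Definition grace_op (n : nat) (T : {poly C} -> {poly C}) : Prop :=
  exists A : seq C,
    forall f, inPn n f -> f != 0 ->
    forall Om, circular_domain Om -> (forall a, a \in A -> Om a) ->
      Zset (T f) `<=` setsum (Zset f) Om.

(* Z(f) as a multiset (sequence of roots with multiplicity), for f != 0 *)
Definition rootsC (f : {poly C}) : seq C :=
  projT1 (closed_field_poly_normal f).

(* Z(f) with None standing for Z(0) = C *)
Definition Zopt (f : {poly C}) : option (seq C) :=
  if f == 0 then None else Some (rootsC f).

Definition dm_seq (s t : seq C) : \bar R :=
  \big[Order.min/+oo%E]_(x <- s) \big[Order.min/+oo%E]_(y <- t)
     (cnorm (x - y))%:E.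

Definition dh_seq (s t : seq C) : \bar R :=
  \big[Order.max/0%E]_(y <- t) \big[Order.min/+oo%E]_(x <- s)
     (cnorm (x - y))%:E.

Definition dH_seq (s t : seq C) : \bar R :=
  Order.max (dh_seq s t) (dh_seq t s).

(* extension of a distance to Z-sets with the stated conventions *)
Definition dist_ext (d : seq C -> seq C -> \bar R)
  (A B : option (seq C)) : \bar R :=
  match A, B with
  | Some [::], Some [::] => 0%E
  | Some [::], _ => +oo%E
  | _, Some [::] => +oo%E
  | None, _ => 0%E
  | _, None => 0%E
  | Some s, Some t => d s t
  end.

Definition d_m := dist_ext dm_seq.
Definition d_h := dist_ext dh_seq.
Definition d_H := dist_ext dH_seq.

(* d_F for multisets of the same size m *)
Definition d_F (U V : seq C) : \bar R :=
  \big[Order.min/+oo%E]_(s : 'S_(size U))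
    \big[Order.max/0%E]_(k < size U) (cnorm (U`_k - V`_(s k)))%:E.

Definition K_m (n : nat) (T : {poly C} -> {poly C}) : \bar R :=
  ereal_sup [set d_m (Zopt f) (Zopt (T f)) | f in [set f | inPn n f]].
Definition K_h (n : nat) (T : {poly C} -> {poly C}) : \bar R :=
  ereal_sup [set d_h (Zopt f) (Zopt (T f)) | f in [set f | inPn n f]].
Definition K_H (n : nat) (T : {poly C} -> {poly C}) : \bar R :=
  ereal_sup [set d_H (Zopt f) (Zopt (T f)) | f in [set f | inPn n f]].
(* only meaningful when T preserves degrees *)
Definition K_F (n : nat) (T : {poly C} -> {poly C}) : \bar R :=
  ereal_sup [set d_F (rootsC f) (rootsC (T f))
            | f in [set f | inPn n f /\ (1 < size f)%N]].

Definition deg_preserving (n : nat) (T : {poly C} -> {poly C}) : Prop :=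
  forall f, inPn n f -> size (T f) = size f.

End Defs.

(* Main.v *)
Require Import Defs.
From HB Require Import structures.
From mathcomp Require Import all_boot all_order all_algebra.
From mathcomp Require Import fingroup perm complex.
From mathcomp Require Import classical_sets reals constructive_ereal ereal.
From mathcomp Require Import boolp ring lra.

(** Every statement is compared with: T is c_0 I + c_1 D + ... + c_n D^n with c_0 <> 0.

    Such a T is a Grace operator: fixing w, the map f |-> (T f)(w) is a linear
    functional whose value on (z - u)^m is (T z^m)(w - u), and Grace's theorem
    follows by taking polar derivatives, using that the inversion a |-> 1/(z - a)
    sends a disk or half-plane avoiding z to a convex set.

    Conversely, if K_m(T) is finite, let T' agree with T on degrees < k, with
    T' = c_0 I + ... + c_(k-1) D^(k-1). Then T (z - a)^k = (T' z^k)(z - a) + q(z)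
    with q independent of a, and a root within r of a bounds q near a by a
    constant independent of a; hence q is constant, which gives c_k.

    For K_F, deform T through the operators with coefficients s^k c_k, 0 <= s <= 1.
    The roots move continuously and stay within a fixed r of the roots of f, so
    each stays in one connected cluster of at most n disks of radius r. *)

Import Order.TTheory GRing.Theory Num.Theory.
Local Open Scope ring_scope.

Set Implicit Arguments.
Unset Strict Implicit.
Unset Printing Implicit Defensive.

(** * The real-valued modulus on the complex numbers *)

Section ComplexNorm.
Context {R : realType}.
Local Notation C := R[i].
Implicit Types (z w : C).

Lemma cnormE z : `|z| = (cnorm z)%:C%C.
Proof. by rewrite /cnorm normc_def. Qed.

Lemma cnorm_ge0 z : 0 <= cnorm z.
Proof. by rewrite -lecR -cnormE normr_ge0. Qed.

Lemma cnorm0 : cnorm (0 : C) = 0.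
Proof. by apply: complexI; rewrite -cnormE normr0. Qed.

Lemma cnorm0_eq0 z : cnorm z = 0 -> z = 0.
Proof. by move=> h; apply: normr0_eq0; rewrite cnormE h. Qed.

Lemma cnorm1 : cnorm (1 : C) = 1.
Proof. by apply: complexI; rewrite -cnormE normr1. Qed.

Lemma cnormM z w : cnorm (z * w) = cnorm z * cnorm w.
Proof. by apply: complexI; rewrite -cnormE normrM !cnormE -rmorphM. Qed.

Lemma cnormX z k : cnorm (z ^+ k) = cnorm z ^+ k.
Proof. by apply: complexI; rewrite -cnormE normrX cnormE -rmorphXn. Qed.

Lemma cnormN z : cnorm (- z) = cnorm z.
Proof. by apply: complexI; rewrite -!cnormE normrN. Qed.

Lemma cnormBC z w : cnorm (z - w) = cnorm (w - z).
Proof. by rewrite -cnormN opprB. Qed.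

Lemma cnormD z w : cnorm (z + w) <= cnorm z + cnorm w.
Proof. by rewrite -lecR rmorphD /= -!cnormE ler_normD. Qed.

Lemma cnormV z : cnorm z^-1 = (cnorm z)^-1.
Proof. by apply: complexI; rewrite -cnormE normfV !cnormE fmorphV. Qed.

Lemma cnorm_real (x : R) : 0 <= x -> cnorm x%:C%C = x.
Proof. by move=> x0; apply: complexI; rewrite -cnormE ger0_norm // ler0c. Qed.

Lemma cnorm_tri z w x : cnorm (z - x) <= cnorm (z - w) + cnorm (w - x).
Proof. by rewrite (_ : z - x = z - w + (w - x)) ?cnormD // addrA subrK. Qed.

Lemma cnorm_sum (I : Type) (s : seq I) (P : pred I) (F : I -> C) :
  cnorm (\sum_(i <- s | P i) F i) <= \sum_(i <- s | P i) cnorm (F i).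
Proof.
elim/big_rec2: _ => [|i y x _ h]; first by rewrite cnorm0.
by apply: le_trans (cnormD _ _) _; rewrite lerD2l.
Qed.

Lemma cnorm_prod (I : Type) (s : seq I) (P : pred I) (F : I -> C) :
  cnorm (\prod_(i <- s | P i) F i) = \prod_(i <- s | P i) cnorm (F i).
Proof. by elim/big_rec2: _ => [|i y x _ h]; rewrite ?cnorm1 // cnormM h. Qed.

Lemma sqr_cnorm z : cnorm z ^+ 2 = complex.Re z ^+ 2 + complex.Im z ^+ 2.
Proof. by apply: complexI; rewrite add_Re2_Im2 cnormE rmorphXn. Qed.

End ComplexNorm.

(** * Disks and half-planes under centroids and inversion *)

Section LaguerreSets.
Context {R : realType}.
Local Notation C := R[i].

(* Closure under centroids, and under centroids computed after sending an
   outside point z to infinity by the inversion a |-> 1 / (z - a). *)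
Definition laguerre_set (K : C -> Prop) : Prop :=
  (forall (s : seq C) v, s != [::] -> (forall a, a \in s -> K a) ->
     \sum_(a <- s) a = (size s)%:R * v -> K v) /\
  (forall z (s : seq C) v, ~ K z -> s != [::] -> (forall a, a \in s -> K a) ->
     z != v -> \sum_(a <- s) (z - a)^-1 = (size s)%:R * (z - v)^-1 -> K v).

(** Disks ([al > 0]) and half-planes ([al = 0]) are sublevel sets of such functions, and the family
    is stable under inversion up to a positive factor, so both shapes are treated together. *)
Definition quad (al be ga de : R) (z : C) : R :=
  al * (complex.Re z ^+ 2 + complex.Im z ^+ 2)
  + be * complex.Re z + ga * complex.Im z + de.

(** Jensen's inequality for a convex quadratic: sum the tangent-plane bound at the centroid, where
    the linear terms cancel. *)
Lemma quad_jensen (al be ga de : R) (s : seq C) (v : C) : 0 <= al ->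
  \sum_(a <- s) a = (size s)%:R * v ->
  (size s)%:R * quad al be ga de v <= \sum_(a <- s) quad al be ga de a.
Proof.
move=> al0 sv.
(* These are the partial derivatives of the quadratic at [v]. *)
pose gr := 2 * al * complex.Re v + be; pose gi := 2 * al * complex.Im v + ga.
have tang a : quad al be ga de v + (gr * complex.Re (a - v) +
    gi * complex.Im (a - v)) <= quad al be ga de a.
  rewrite -subr_ge0 /gr /gi /quad; case: a (v) => [x y] [x0 y0] /=.
  set A := (X in 0 <= X); have -> : A = al * ((x - x0) ^+ 2 + (y - y0) ^+ 2).
    by rewrite /A; ring.
  by apply: mulr_ge0 => //; apply: addr_ge0; exact: sqr_ge0.
(* The centroid relation fails for sublists, so the induction carries the linear terms; they vanish
   once [t] is [s]. *)
have lin0 : forall t : seq C,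
   gr * complex.Re (\sum_(a <- t) a - (size t)%:R * v) +
   gi * complex.Im (\sum_(a <- t) a - (size t)%:R * v) + (size t)%:R * quad al be ga de v
   <= \sum_(a <- t) quad al be ga de a.
  elim=> [|a t IH]; first by rewrite !big_nil /= !mul0r subr0 /= !mulr0 !addr0.
  rewrite !big_cons /= -add1n !natrD !mulrDl !mul1r.
  apply: le_trans (lerD (tang a) IH).
  rewrite le_eqVlt; apply/orP; left; apply/eqP.
  set S := \sum_(_ <- _) _; set M := (size t)%:R * v.
  rewrite (_ : a + S - (v + M) = (a - v) + (S - M)); last by ring.
  by rewrite /gr /gi; case: (a - v) (S - M) => [x y] [x' y'] /=; ring.
by have := lin0 s; rewrite sv subrr /= !mulr0 !add0r.
Qed.

Lemma quad_sum_lteif b (al be ga de : R) (s : seq C) : s != [::] ->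
  (forall a, a \in s -> quad al be ga de a < 0 ?<= if b) ->
  \sum_(a <- s) quad al be ga de a < 0 ?<= if b.
Proof.
elim: s => // a s IH _ h; rewrite big_cons.
have ha : quad al be ga de a < 0 ?<= if b by apply: h; rewrite mem_head.
case: (eqVneq s [::]) IH => [->|sn] IH; first by rewrite big_nil addr0.
have {}IH : \sum_(a <- s) quad al be ga de a < 0 ?<= if b.
  by apply: IH => // x xs; apply: h; rewrite inE xs orbT.
by case: b ha IH {h} => /= ? ?; lra.
Qed.

Lemma quad_mean b (al be ga de : R) (s : seq C) (v : C) : 0 <= al -> s != [::] ->
  (forall a, a \in s -> quad al be ga de a < 0 ?<= if b) ->
  \sum_(a <- s) a = (size s)%:R * v -> quad al be ga de v < 0 ?<= if b.
Proof.
move=> al0 sn h /(quad_jensen be ga de al0) J.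
have S := quad_sum_lteif sn h.
have n0 : 0 < (size s)%:R :> R by rewrite ltr0n; case: (s) sn.
case: b S {h} => /= S.
  by rewrite -(pmulr_rle0 _ n0); apply: le_trans J S.
by rewrite -(pmulr_rlt0 _ n0); apply: le_lt_trans J S.
Qed.

(** Expand at [a = z - d] and divide by the squared modulus of [d]. The new leading coefficient is
    the value of the quadratic at [z], hence nonnegative when [z] lies outside the sublevel set. *)
Lemma quad_inversion (al be ga de : R) (z a : C) : z != a ->
  quad al be ga de a = cnorm (z - a) ^+ 2 *
    quad (quad al be ga de z) (- 2 * al * complex.Re z - be)
         (2 * al * complex.Im z + ga) al (z - a)^-1.
Proof.
rewrite -subr_eq0 => za; rewrite sqr_cnorm.
have [d dE] : exists d, d = z - a by exists (z - a).
rewrite -!dE in za *; rewrite (_ : a = z - d); last by rewrite dE subKr.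
case: z d za {a dE} => [x y] [p q] za; rewrite /quad /=.
have N : p ^+ 2 + q ^+ 2 != 0.
  apply: contra za; rewrite paddr_eq0 ?sqr_ge0 // !sqrf_eq0 => /andP[/eqP-> /eqP->].
  by rewrite eq_complex /= eqxx.
by field.
Qed.

(** Seen from a point [z] outside, the inverted quadratic is again convex, so the centroid property
    applies to the inverted points. *)
Lemma laguerre_quad b (al be ga de : R) : 0 <= al ->
  laguerre_set (fun z => quad al be ga de z < 0 ?<= if b).
Proof.
move=> al0; split=> [s v sn sK|z s v zK sn sK zv] Hs; first exact: quad_mean al0 sn sK Hs.
have Qz : 0 <= quad al be ga de z.
  by case: b zK {sK} => /= /negP; rewrite -?ltNge -?leNgt // => /ltW.
have za a : a \in s -> z != a.
  by move=> /sK aK; apply/eqP => zea; apply: zK; rewrite zea.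
have pos w : z != w -> 0 < cnorm (z - w) ^+ 2.
  move=> zw; rewrite exprn_gt0 // lt_def cnorm_ge0 andbT.
  by apply: contraNneq zw => /cnorm0_eq0/eqP; rewrite subr_eq0.
have sgn w : z != w -> (quad al be ga de w < 0 ?<= if b) =
    (quad (quad al be ga de z) (- 2 * al * complex.Re z - be)
         (2 * al * complex.Im z + ga) al (z - w)^-1 < 0 ?<= if b).
  move=> zw; rewrite [X in X < 0 ?<= if b](quad_inversion _ _ _ _ zw).
  by case: (b); rewrite /= ?(pmulr_rle0 _ (pos _ zw)) ?(pmulr_rlt0 _ (pos _ zw)).
rewrite sgn //; apply: (@quad_mean b _ _ _ _ [seq (z - a)^-1 | a <- s]) => //.
- by case: (s) sn.
- by move=> _ /mapP[a as_ ->]; rewrite -sgn ?za ?sK.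
- by rewrite big_map size_map.
Qed.

Lemma laguerre_set_ext K K' : (forall z, K z <-> K' z) ->
  laguerre_set K -> laguerre_set K'.
Proof. by move=> KK'; rewrite (_ : K = K') //; apply/funext => z; apply/propext. Qed.

Lemma laguerre_reflect (w : C) K : laguerre_set K -> laguerre_set (fun u => K (w - u)).
Proof.
case=> K1 K2; split=> [s v sn sK|z s v zK sn sK zv] Hs.
- apply: (K1 [seq w - a | a <- s]); first by case: (s) sn.
    by move=> _ /mapP[a as_ ->]; apply: sK.
  rewrite big_map size_map mulrBr -Hs big_split /= -sumrN; congr (_ + _).
  by rewrite big_const_seq count_predT iter_addr_0 mulr_natl.
- apply: (K2 (w - z) [seq w - a | a <- s]) => //; first by case: (s) sn.
    by move=> _ /mapP[a as_ ->]; apply: sK.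
    by rewrite (inj_eq (addrI _)) eqr_opp.
  rewrite big_map size_map.
  have E a : w - z - (w - a) = - (z - a) by ring.
  rewrite E invrN mulrN -Hs -sumrN; apply: eq_bigr => a _.
  by rewrite E invrN.
Qed.

Lemma quad_disk (c z : C) (r : R) :
  quad 1 (- 2 * complex.Re c) (- 2 * complex.Im c)
    (complex.Re c ^+ 2 + complex.Im c ^+ 2 - r ^+ 2) z = cnorm (z - c) ^+ 2 - r ^+ 2.
Proof. by rewrite sqr_cnorm; case: z c => [x y] [p q]; rewrite /quad /=; ring. Qed.

Lemma laguerre_disk b (c : C) (r : R) : 0 < r ->
  laguerre_set (fun z => cnorm (z - c) < r ?<= if b).
Proof.
move=> r0; apply: laguerre_set_ext (laguerre_quad b (- 2 * complex.Re c)
   (- 2 * complex.Im c) (complex.Re c ^+ 2 + complex.Im c ^+ 2 - r ^+ 2) ler01) => z.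
rewrite quad_disk; case: b => /=;
by rewrite ?subr_le0 ?subr_lt0 ?ler_pXn2r ?ltr_pXn2r // nnegrE ?cnorm_ge0 // ltW.
Qed.

Lemma laguerre_halfplane b (c u : C) :
  laguerre_set (fun z => 0 < complex.Re ((z - c) * (u^*)%C) ?<= if b).
Proof.
apply: laguerre_set_ext (laguerre_quad b (- complex.Re u) (- complex.Im u)
    (complex.Re c * complex.Re u + complex.Im c * complex.Im u) (lexx 0)) => -[x y].
case: c u => [p q] [s t]; rewrite /quad /=.
set B := _ + _ + _ + _; set A := (X in _ <-> _ < X ?<= if _).
have -> : A = - B by rewrite /A /B; ring.
by case: b; rewrite /= ?oppr_ge0 ?oppr_gt0.
Qed.

(** Exteriors of disks are not convex, but their complements are disks; this dichotomy is why
    Grace's theorem is proved in two forms below. *)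
Lemma circular_domain_laguerre (Om : C -> Prop) : circular_domain Om ->
  laguerre_set Om \/ laguerre_set (fun z => ~ Om z).
Proof.
case=> [[c [r [r0 [] ->]]]|[c [u [_ [] ->]]]].
- by left; apply: (laguerre_disk false).
- by left; apply: (laguerre_disk true).
- right; apply: laguerre_set_ext (laguerre_disk true c r0) => z /=.
  by rewrite leNgt; split=> /negP.
- right; apply: laguerre_set_ext (laguerre_disk false c r0) => z /=.
  by rewrite ltNge; split=> /negP.
- by left; apply: (laguerre_halfplane false).
- by left; apply: (laguerre_halfplane true).
Qed.

End LaguerreSets.

(** * Laguerre's theorem on polar derivatives, and Grace's theorem *)

Lemma horner_deriv_prod_XsubC (F : fieldType) (s : seq F) (z : F) :
  z \notin s ->
  (\prod_(a <- s) ('X - a%:P))^`().[z] =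
  (\prod_(a <- s) ('X - a%:P)).[z] * \sum_(a <- s) (z - a)^-1.
Proof.
elim: s => [|a s IH]; first by rewrite !big_nil derivC !hornerE.
rewrite inE negb_or => /andP[za zs]; rewrite !big_cons derivM derivXsubC !hornerE IH //.
have D : z - a != 0 by rewrite subr_eq0.
by rewrite mulrDr mulrAC (divff D) mul1r mulrA.
Qed.

Section Grace.
Context {R : realType}.
Local Notation C := R[i].
Implicit Types (l : nat -> C) (v : C).

(** Laguerre's theorem; [q] is the normalized polar derivative of [p] at [v]. A root [z] of [q]
    outside [K] would, by the logarithmic derivative, make [v] the centroid of the roots of [p] seen
    from [z]. A drop of degree would make [v] their ordinary centroid. Both force [v] into [K]. *)
Lemma laguerre_polar (K : C -> Prop) (p q : {poly C}) m v :
  laguerre_set K -> size p = m.+2 -> (forall z, root p z -> K z) -> ~ K v ->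
  (size q <= m.+1)%N -> m.+1%:R *: q = m.+1%:R *: p + (v%:P - 'X) * p^`() ->
  size q = m.+1 /\ forall z, root q z -> K z.
Proof.
move=> [K1 K2] sp pK vK sq E.
have [s ps] := closed_field_poly_normal p.
have lp : lead_coef p != 0 by rewrite lead_coef_eq0 -size_poly_eq0 sp.
have ss : size s = m.+1.
  by apply/eqP; rewrite -eqSS -sp ps size_scale // size_prod_XsubC.
have sK a : a \in s -> K a.
  by move=> a_s; apply: pK; rewrite ps rootZ // root_prod_XsubC.
have sn : s != [::] by rewrite -size_eq0 ss.
have m0 : m.+1%:R != 0 :> C by rewrite pnatr_eq0.
(* By Vieta, the top coefficient of [q] measures how far [v] is from the centroid of the roots. *)
have qm : m.+1%:R * q`_m = lead_coef p * (m.+1%:R * v - \sum_(a <- s) a).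
  rewrite -coefZ E coefD coefZ mulrBl coefB coefCM coefXM !coef_deriv.
  have pm : p`_m = - lead_coef p * \sum_(a <- s) a.
    rewrite {1}ps coefZ; have := @coefPn_prod_XsubC _ s; rewrite ss /= => /(_ isT) ->.
    by rewrite mulrN mulNr.
  have pm1 : p`_m.+1 = lead_coef p by rewrite lead_coefE sp.
  have -> : (if m == 0%N then 0 else p`_m.-1.+1 *+ m.-1.+1) = m%:R * p`_m.
    by case: (m) => [|k]; rewrite /= ?mul0r // mulr_natl.
  by rewrite pm1 pm -mulr_natl; ring.
split.
  apply/eqP; rewrite eqn_leq sq /= ltnNge; apply/negP => /leq_sizeP/(_ m (leqnn m)) qm0.
  move: qm; rewrite qm0 mulr0 => /esym/eqP; rewrite mulf_eq0 (negPf lp) /= subr_eq0 => /eqP h.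
  by apply: vK; apply: (K1 s) => //; rewrite ss.
move=> z; rewrite /root => /eqP qz; apply: contrapT => zK.
have zs : z \notin s by apply/negP => /sK.
have pz : p.[z] != 0 by apply/negP => /pK.
have := congr1 (fun r => r.[z]) E; rewrite /= !hornerE qz mulr0 => /esym H.
have zv : z != v.
  apply: contra_neq pz => zv; apply: (mulfI m0).
  by move: H; rewrite zv subrr mul0r addr0 mulr0.
apply: vK; apply: (K2 z s) => //.
have Pz : (\prod_(a <- s) ('X - a%:P)).[z] != 0.
  by apply: contra pz; rewrite ps hornerZ => /eqP->; rewrite mulr0.
move: H; rewrite ps derivZ !hornerZ horner_deriv_prod_XsubC // ss.
move: (\prod_(a <- s) ('X - a%:P)).[z] Pz => P Pz.
move: (\sum_(a <- s) (z - a)^-1) => S H.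
have D : z - v != 0 by rewrite subr_eq0.
apply: (mulIf D); rewrite -mulrA mulVf // mulr1.
apply: (mulfI (mulf_neq0 lp Pz)); apply/eqP; rewrite -subr_eq0.
rewrite -[_ - _]opprK -[X in _ == X]oppr0 eqr_opp; apply/eqP.
by rewrite -[RHS]H; ring.
Qed.

(* The functional X^i |-> l i on polynomials, and the polynomial
   u |-> moment l (('X - u) ^ m). *)
Definition moment l (h : {poly C}) : C := \sum_(i < size h) h`_i * l i.

Definition moment_poly l m : {poly C} :=
  \poly_(i < m.+1) ((-1) ^+ i * 'C(m, i)%:R * l (m - i)%N).

Lemma moment_wide l (h : {poly C}) N : (size h <= N)%N ->
  moment l h = \sum_(i < N) h`_i * l i.
Proof.
move=> hN; rewrite /moment (big_ord_widen N (fun i => h`_i * l i)) // big_mkcond.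
by apply: eq_bigr => i _; case: ltnP => // /(nth_default 0) ->; rewrite mul0r.
Qed.

Lemma moment_XsubC l v h :
  moment l (('X - v%:P) * h) = moment (fun i => l i.+1 - v * l i) h.
Proof.
have s1 : (size (('X - v%:P) * h)%R <= (size h).+1)%N.
  by apply: leq_trans (size_polyMleq _ _) _; rewrite size_XsubC.
rewrite (moment_wide _ s1) [RHS](moment_wide _ (leqnSn _)).
under eq_bigr => i _ do rewrite mulrBl coefB coefXM coefCM mulrBl.
rewrite sumrB big_ord_recl /= mul0r add0r.
rewrite [in RHS]big_ord_recr /= nth_default // mul0r addr0.
rewrite big_ord_recr /= nth_default // mulr0 mul0r addr0 -sumrB.
by apply: eq_bigr => i _; rewrite /bump /=; ring.
Qed.

(** The change of sequence that absorbs a factor ['X - v%:P] in [moment_XsubC] acts on moment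
    polynomials as the polar derivative at [v]. Together the two facts drive the induction for
    Grace's theorem. *)
Lemma moment_poly_polar l v m :
  m.+1%:R *: moment_poly (fun i => l i.+1 - v * l i) m =
  m.+1%:R *: moment_poly l m.+1 + (v%:P - 'X) * (moment_poly l m.+1)^`().
Proof.
apply/polyP => i; rewrite coefD !coefZ mulrBl coefB coefCM coefXM !coef_deriv !coef_poly.
have -> : (if i == 0%N then 0 else (if (i.-1.+1 < m.+2)%N
     then (-1) ^+ i.-1.+1 * 'C(m.+1, i.-1.+1)%:R * l (m.+1 - i.-1.+1)%N else 0) *+ i.-1.+1)
   = i%:R * (if (i < m.+2)%N then (-1) ^+ i * 'C(m.+1, i)%:R * l (m.+1 - i)%N else 0) :> C.
  by case: i => [|i]; rewrite /= ?mul0r // mulr_natl.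
rewrite !ltnS subSS; have [im|im] := leqP i m.
- rewrite (leq_trans im (leqnSn m)) -mulr_natl subSn //.
  have e1 : i.+1%:R * 'C(m.+1, i.+1)%:R = m.+1%:R * 'C(m, i)%:R :> C.
    by rewrite -!natrM -mul_bin_diag.
  have e2 : (m.+1%:R - i%:R) * 'C(m.+1, i)%:R = m.+1%:R * 'C(m, i)%:R :> C.
    by rewrite -natrB ?(leq_trans im) // -!natrM -mul_bin_down.
  transitivity ((-1) ^+ i * (m.+1%:R * 'C(m, i)%:R) * (l (m - i).+1 - v * l (m - i)%N)).
    by ring.
  rewrite mulrBr -{1}e2 -e1 exprS; ring.
(* In degree [m.+1] the two contributions on the right cancel. *)
- rewrite mul0rn; have [->|ne] := eqVneq i m.+1; first by rewrite leqnn; ring.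
  by rewrite leqNgt ltn_neqAle eq_sym ne im /=; ring.
Qed.

(** Remove the roots [v] one at a time: by Laguerre's theorem each polar derivative keeps its roots
    in [K] and loses exactly one degree, until a nonzero constant remains, which is the moment. *)
Lemma grace_laguerre K (s : seq C) l : laguerre_set K ->
  size (moment_poly l (size s)) = (size s).+1 ->
  (forall z, root (moment_poly l (size s)) z -> K z) ->
  (forall v, v \in s -> ~ K v) -> moment l (\prod_(v <- s) ('X - v%:P)) != 0.
Proof.
move=> lK; elim: s l => [|v s IH] l sz zK sK.
  rewrite big_nil /moment size_poly1 big_ord1 coef1 mul1r.
  apply: contra_eqN sz => /eqP l0; rewrite (_ : moment_poly _ _ = 0) ?size_poly0 //.
  apply/polyP => -[|i]; rewrite coef_poly coef0 //=.
  by rewrite subnn l0 mulr0.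
rewrite big_cons moment_XsubC.
have [sz' zK'] := laguerre_polar lK sz zK (sK v (mem_head _ _)) (size_poly _ _)
  (moment_poly_polar l v (size s)).
by apply: IH => // w ws; apply: sK; rewrite inE ws orbT.
Qed.

(* Apolarity is symmetric: the moment sequence l' below has moment polynomial
   the given product, and pairs with [moment_poly l m] as l does with it. *)
Lemma grace_laguerre_compl K (s : seq C) l : laguerre_set K ->
  size (moment_poly l (size s)) = (size s).+1 ->
  (forall z, root (moment_poly l (size s)) z -> ~ K z) ->
  (forall v, v \in s -> K v) -> moment l (\prod_(v <- s) ('X - v%:P)) != 0.
Proof.
move=> lK sz zK sK; set m := size s in sz zK *; set f := \prod_(v <- s) _.
have sf : size f = m.+1 by rewrite size_prod_XsubC.
(* Obtained by solving [moment_poly l' m = f] for the sequence. *)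
pose l' i : C := (-1) ^+ (m - i) * f`_(m - i) / 'C(m, i)%:R.
have fE : moment_poly l' m = f.
  apply/polyP => i; rewrite coef_poly; case: ltnP => im; last by rewrite nth_default ?sf.
  rewrite /l' subKn // bin_sub //.
  have c0 : 'C(m, i)%:R != 0 :> C by rewrite pnatr_eq0 -lt0n bin_gt0.
  have sg : (-1) ^+ i * (-1) ^+ i = 1 :> C by rewrite -exprMn mulN1r opprK expr1n.
  transitivity ((-1) ^+ i * (-1) ^+ i * f`_i * ('C(m, i)%:R / 'C(m, i)%:R)); first by ring.
  by rewrite sg divff // mul1r mulr1.
have [t pt] := closed_field_poly_normal (moment_poly l m).
set p := moment_poly l m in sz zK pt *.
have lp : lead_coef p != 0 by rewrite lead_coef_eq0 -size_poly_eq0 sz.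
have st : size t = m.
  by apply/eqP; rewrite -eqSS -sz pt size_scale // size_prod_XsubC.
have pair : moment l' p = (-1) ^+ m * moment l f.
  rewrite (@moment_wide l' p m.+1) ?sz // (@moment_wide l f m.+1) ?sf //.
  rewrite (reindex_inj rev_ord_inj) /= mulr_sumr; apply: eq_bigr => i _.
  have im : (i <= m)%N by rewrite -ltnS.
  rewrite subSS coef_poly ltnS leq_subr /l' subKn // bin_sub //.
  have c0 : 'C(m, i)%:R != 0 :> C by rewrite pnatr_eq0 -lt0n bin_gt0.
  have -> : (-1) ^+ m = (-1) ^+ (m - i) * (-1) ^+ i :> C by rewrite -exprD subnK.
  by field.
(* The roles are now exchanged: the roots of [f] lie in [K], and polar derivatives are taken at the
   roots [t] of [p], which lie outside. *)
apply: contra_neq lp => lf0.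
have : moment l' (\prod_(v <- t) ('X - v%:P)) != 0.
  apply: (grace_laguerre lK); rewrite ?st ?fE //.
  - by move=> z; rewrite root_prod_XsubC => /sK.
  - move=> v vt; apply: zK; rewrite pt rootE hornerZ.
    have : root (\prod_(v <- t) ('X - v%:P)) v by rewrite root_prod_XsubC.
    by rewrite /root => /eqP->; rewrite mulr0.
set q := \prod_(v <- t) _ in pt * => nz.
have pc i : p`_i = lead_coef p * q`_i by rewrite -coefZ -pt.
have sq : size q = m.+1 by rewrite size_prod_XsubC st.
have E : moment l' p = lead_coef p * moment l' q.
  rewrite (@moment_wide l' p m.+1) ?sz // (@moment_wide l' q m.+1) ?sq //.
  by rewrite mulr_sumr; apply: eq_bigr => i _; rewrite pc -mulrA.
by move: pair; rewrite E lf0 mulr0 => /eqP; rewrite mulf_eq0 (negPf nz) orbF => /eqP.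
Qed.

End Grace.

(** * Polynomials and their lists of roots *)

Section RootSequences.
Context {R : realType}.
Local Notation C := R[i].
Implicit Types f : {poly C}.

Lemma rootsC_prod f : f = lead_coef f *: \prod_(z <- rootsC f) ('X - z%:P).
Proof. by rewrite /rootsC; case: closed_field_poly_normal. Qed.

Lemma mem_rootsC f z : f != 0 -> (z \in rootsC f) = root f z.
Proof.
by move=> f0; rewrite [in RHS](rootsC_prod f) rootZ ?lead_coef_eq0 // root_prod_XsubC.
Qed.

Lemma size_rootsC f : size (rootsC f) = (size f).-1 \/ f = 0.
Proof.
have [->|f0] := eqVneq f 0; [by right | left].
by rewrite [in RHS](rootsC_prod f) size_scale ?lead_coef_eq0 // size_prod_XsubC.
Qed.

End RootSequences.

(** * Constant-coefficient differential operators and the location of their roots *)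

Section DiffOp.
Context {R : realType}.
Local Notation C := R[i].
Implicit Types (c : nat -> C) (f : {poly C}).

Definition diffop c n f : {poly C} := \sum_(k < n.+1) c k *: f^`(k).

Lemma diffop_is_linear c n : linear (diffop c n).
Proof.
move=> a f g; rewrite /diffop scaler_sumr -big_split; apply: eq_bigr => k _ /=.
by rewrite linearP scalerDr !scalerA mulrC.
Qed.

HB.instance Definition _ c n :=
  GRing.isLinear.Build C {poly C} {poly C} _ (diffop c n) (diffop_is_linear c n).

Lemma diffop0 c n : diffop c n 0 = 0.
Proof. exact: linear0. Qed.

Lemma derivn_comp_XsubC f a k : (f \Po ('X - a%:P))^`(k) = f^`(k) \Po ('X - a%:P).
Proof.
elim: k => [|k IH]; rewrite ?derivn0 //.
by rewrite !derivnS IH deriv_comp derivXsubC mulr1.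
Qed.

Lemma diffop_comp_XsubC c n f a :
  diffop c n (f \Po ('X - a%:P)) = diffop c n f \Po ('X - a%:P).
Proof.
rewrite /diffop [RHS]linear_sum; apply: eq_bigr => k _ /=.
by rewrite derivn_comp_XsubC comp_polyZ.
Qed.

Lemma diffop_lead c n f : f != 0 ->
  exists2 g, diffop c n f = c 0%N *: f + g & (size g < size f)%N.
Proof.
move=> f0; exists (\sum_(k < n) c k.+1 *: f^`(k.+1)).
  by rewrite /diffop big_ord_recl derivn0.
rewrite -[size f]prednK ?size_poly_gt0 // ltnS; apply/leq_sizeP => j fj.
rewrite coef_sum big1 // => k _; rewrite coefZ coef_derivn nth_default ?mul0rn ?mulr0 //.
by rewrite -[size f]prednK ?size_poly_gt0 // addSn ltnS (leq_trans fj) // leq_addl.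
Qed.

Lemma size_diffop c n f : c 0%N != 0 -> size (diffop c n f) = size f.
Proof.
move=> c0; have [->|f0] := eqVneq f 0; first by rewrite linear0.
by have [g -> gf] := diffop_lead c n f0; rewrite size_polyDl size_scale.
Qed.

Lemma lead_coef_diffop c n f : c 0%N != 0 -> lead_coef (diffop c n f) = c 0%N * lead_coef f.
Proof.
move=> c0; have [->|f0] := eqVneq f 0; first by rewrite linear0 lead_coef0 mulr0.
by have [g -> gf] := diffop_lead c n f0; rewrite lead_coefDl ?lead_coefZ ?size_scale.
Qed.

Lemma diffop_eq0 c n f : c 0%N != 0 -> (diffop c n f == 0) = (f == 0).
Proof. by move=> c0; rewrite -!size_poly_eq0 size_diffop. Qed.

Lemma diffop1 c n : diffop c n 1 = (c 0%N)%:P.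
Proof.
rewrite /diffop big_ord_recl derivn0 big1 ?addr0 ?alg_polyC // => k _.
by rewrite derivnC /= scaler0.
Qed.

Lemma moment_diffop c n w f :
  moment (fun j => (diffop c n 'X^j).[w]) f = (diffop c n f).[w].
Proof.
rewrite -[in RHS](coefK f) poly_def linear_sum horner_sum.
by apply: eq_bigr => i _; rewrite linearZ hornerZ.
Qed.

(** By translation invariance, applying the operator to [('X - u%:P) ^+ m] and evaluating at [w]
    gives this value. So the roots of the moment polynomial are the points [w - a] with [a] a zero
    of the image of ['X^m]. *)
Lemma horner_moment_poly_diffop c n w m u :
  (moment_poly (fun j => (diffop c n 'X^j).[w]) m).[u] = (diffop c n 'X^m).[w - u].
Proof.
transitivity (diffop c n (('X - u%:P) ^+ m)).[w]; last first.
  by rewrite -comp_Xn_poly diffop_comp_XsubC horner_comp !hornerE.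
rewrite horner_poly exprBn linear_sum horner_sum; apply: eq_bigr => i _ /=.
have -> : (-1) ^+ i * 'X^(m - i) * u%:P ^+ i *+ 'C(m, i) =
    ((-1) ^+ i * u ^+ i * 'C(m, i)%:R) *: 'X^(m - i) :> {poly C}.
  by rewrite -mul_polyC !rmorphM /= !rmorphXn /= rmorphN1 rmorph_nat -mulr_natl; ring.
by rewrite linearZ hornerZ; ring.
Qed.

(** If every root of [f] avoided the reflected domain [w - Om], which contains all roots of the
    moment polynomial, Grace's theorem would make the image of [f] nonzero at [w]. *)
Lemma diffop_grace c n f m (Om : C -> Prop) w : c 0%N != 0 -> size f = m.+1 ->
  circular_domain Om -> (forall a, root (diffop c n 'X^m) a -> Om a) ->
  root (diffop c n f) w -> exists u, root f u /\ Om (w - u).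
Proof.
move=> c0 sf cOm AOm Tw; apply: contrapT => nex.
pose l j := (diffop c n 'X^j).[w]; pose s := rootsC f.
have f0 : f != 0 by rewrite -size_poly_eq0 sf.
have ss : size s = m by case: (size_rootsC f) => [|/eqP]; rewrite ?sf // (negPf f0).
have szP : size (moment_poly l (size s)) = (size s).+1.
  rewrite ss; apply: size_poly_eq; rewrite subnn binn mulr1 mulf_neq0 ?signr_eq0 //.
  by rewrite /l expr0 diffop1 hornerC.
have zP z : root (moment_poly l (size s)) z -> Om (w - z).
  by rewrite /root horner_moment_poly_diffop ss => /AOm.
have sP v : v \in s -> ~ Om (w - v).
  by rewrite mem_rootsC // => fv Omv; apply: nex; exists v.
suff : moment l (\prod_(v <- s) ('X - v%:P)) != 0.
  rewrite moment_diffop => /negP; apply.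
  move: Tw; rewrite rootE [f in diffop _ _ f](rootsC_prod f) linearZ hornerZ mulf_eq0.
  by rewrite lead_coef_eq0 (negPf f0).
have [lK|lK] := circular_domain_laguerre cOm.
  exact: (grace_laguerre (laguerre_reflect w lK)) szP zP sP.
apply: (grace_laguerre_compl (laguerre_reflect w lK)) szP _ sP => z /zP Oz.
by apply.
Qed.

(** Plays the part of the finite set [A] in the definition of a Grace operator. *)
Definition diffop_zeros c n N : seq C :=
  flatten [seq rootsC (diffop c n 'X^m) | m <- iota 0 N.+1].

Lemma mem_diffop_zeros c n N m a : c 0%N != 0 -> (m <= N)%N ->
  root (diffop c n 'X^m) a -> a \in diffop_zeros c n N.
Proof.
move=> c0 mN ra; apply/flattenP; exists (rootsC (diffop c n 'X^m)).
  by apply/mapP; exists m; rewrite ?mem_iota ?add0n ?ltnS.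
by rewrite mem_rootsC // diffop_eq0 // -size_poly_eq0 size_polyXn.
Qed.

Lemma seq_cnorm_bound (s : seq C) : exists2 r : R, 0 < r & forall a, a \in s -> cnorm a <= r.
Proof.
elim: s => [|a s [r r0 IH]]; first by exists 1.
exists (cnorm a + r) => [|x]; first by rewrite ltr_wpDl ?cnorm_ge0.
rewrite inE => /orP[/eqP->|/IH]; first by rewrite lerDl ltW.
by move=> xr; rewrite (le_trans xr) // lerDr cnorm_ge0.
Qed.

(** For nonzero [s] this conjugates the operator by the dilation of ratio [s]; at [s = 0] only [c 0]
    times the identity is left. *)
Definition dilate c (s : R) : nat -> C := fun k => (s%:C%C) ^+ k * c k.

Lemma horner_diffop_dilate c n s m z : s != 0 ->
  (diffop (dilate c s) n 'X^m).[z] = (s%:C%C) ^+ m * (diffop c n 'X^m).[z / s%:C%C].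
Proof.
move=> s0; rewrite !horner_sum mulr_sumr; apply: eq_bigr => k _.
rewrite !hornerZ derivnXn !hornerMn !hornerXn /dilate.
have [km|mk] := leqP k m; last by rewrite ffact_small // !mulr0n !mulr0.
have S0 : s%:C%C != 0 :> C by rewrite fmorph_eq0.
have -> : s%:C%C ^+ m = s%:C%C ^+ (m - k) * s%:C%C ^+ k :> C by rewrite -exprD subnK.
rewrite !mulrnAr; congr (_ *+ _).
have -> : (z / s%:C%C) ^+ (m - k) = z ^+ (m - k) / s%:C%C ^+ (m - k) by rewrite expr_div_n.
have := expf_neq0 (m - k) S0.
move: (s%:C%C ^+ (m - k)) (s%:C%C ^+ k) (z ^+ _) (c k) => x y t e x0.
by field.
Qed.

Lemma diffop_dilate0 c n f : diffop (dilate c 0) n f = c 0%N *: f.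
Proof.
rewrite /diffop big_ord_recl big1 => [|k _]; first by rewrite /dilate mul1r derivn0 addr0.
by rewrite /dilate expr0n /= mul0r scale0r.
Qed.

(** Dilation multiplies the zeros of the images of monomials by [s], so for [s] in [0, 1] a single
    closed disk about 0 contains them all, and [diffop_grace] applies with a radius independent of
    [s]. *)
Lemma diffop_root_near c n N : c 0%N != 0 ->
  exists2 r : R, 0 < r & forall s f w, 0 <= s <= 1 -> f != 0 -> (size f <= N.+1)%N ->
    root (diffop (dilate c s) n f) w -> exists2 u, root f u & cnorm (w - u) <= r.
Proof.
move=> c0; have [r r0 Hr] := seq_cnorm_bound (diffop_zeros c n N).
exists r => // s f w /andP[s0 s1] f0 fN.
have [->|sn] := eqVneq s 0.
  rewrite diffop_dilate0 rootZ // => fw; exists w => //.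
  by rewrite subrr cnorm0 ltW.
have d0 : dilate c s 0%N != 0 by rewrite /dilate expr0 mul1r.
case sf : (size f) fN => [|m] mN; first by move/eqP: sf; rewrite size_poly_eq0 (negPf f0).
have cd : circular_domain (fun z : C => is_true (cnorm (z - 0) <= r)).
  by left; exists 0, r; split=> //; apply: Or42.
move=> Tw; have [|u [fu Ou]] := diffop_grace d0 sf cd _ Tw; last first.
  by exists u => //; rewrite subr0 in Ou.
move=> a; rewrite rootE horner_diffop_dilate // mulf_eq0 expf_eq0 fmorph_eq0 (negPf sn) andbF /=.
move=> /(mem_diffop_zeros c0 (mN : (m <= N)%N))/Hr; rewrite subr0 cnormM cnormV cnorm_real //.
rewrite ler_pdivrMr ?lt_def ?sn // => h; apply: le_trans h _.
by rewrite ger_pMr.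
Qed.

End DiffOp.

(** * Continuous dependence of the roots on the coefficients *)

Section RootContinuity.
Context {R : realType}.
Local Notation C := R[i].

Definition roots_poly m (u : 'I_m -> C) : {poly C} := \prod_(k < m) ('X - (u k)%:P).

Lemma size_roots_poly m (u : 'I_m -> C) : size (roots_poly u) = m.+1.
Proof. by rewrite size_prod_XsubC [index_enum _]unlock -enumT size_enum_ord. Qed.

Definition coef_norm (p : {poly C}) : R := \sum_(i < size p) cnorm p`_i.

Lemma coef_norm_ge0 p : 0 <= coef_norm p.
Proof. by apply: sumr_ge0 => i _; apply: cnorm_ge0. Qed.

Lemma le_coef_norm (p : {poly C}) i : cnorm p`_i <= coef_norm p.
Proof.
have [ip|pi] := ltnP i (size p); last by rewrite nth_default ?cnorm0 ?coef_norm_ge0.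
rewrite /coef_norm (bigD1 (Ordinal ip)) //= lerDl.
by apply: sumr_ge0 => k _; apply: cnorm_ge0.
Qed.

(** Synthetic division from the top coefficient down: each step multiplies the bound by at most
    [1 + B]. *)
Lemma coef_divXsubC_bound (b : C) (B g : R) (H : {poly C}) m :
  (size H <= m)%N -> cnorm b <= B -> (forall i, cnorm ((('X - b%:P) * H)`_i) <= g) ->
  forall i, cnorm H`_i <= (1 + B) ^+ m * g.
Proof.
move=> sH bB Gg; have B0 : 0 <= B := le_trans (cnorm_ge0 b) bB.
have g0 : 0 <= g := le_trans (cnorm_ge0 _) (Gg 0%N).
suff st j i : (m <= i + j)%N -> cnorm H`_i <= (1 + B) ^+ j * g.
  by move=> i; apply: st; apply: leq_addl.
elim: j i => [|j IH] i mij.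
  by rewrite nth_default ?cnorm0 ?mul1r // (leq_trans sH) // -(addn0 i).
have Hi : H`_i = (('X - b%:P) * H)`_i.+1 + b * H`_i.+1.
  by rewrite mulrBl coefB coefXM coefCM /= subrK.
have {}IH : cnorm H`_i.+1 <= (1 + B) ^+ j * g by apply: IH; rewrite addSnnS.
rewrite Hi (le_trans (cnormD _ _)) // cnormM exprS.
have p1 : 1 <= (1 + B) ^+ j by rewrite exprn_ege1 // lerDl.
apply: le_trans (lerD (Gg _) (ler_pM (cnorm_ge0 b) (cnorm_ge0 _) bB IH)) _.
by have := mulr_ge0 (_ : 0 <= (1 + B) ^+ j - 1) g0; rewrite subr_ge0 => /(_ p1); lra.
Qed.

Lemma horner_bound (p : {poly C}) (a : C) (d : R) m :
  (size p <= m)%N -> (forall i, cnorm p`_i <= d) ->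
  cnorm p.[a] <= d * \sum_(i < m) cnorm a ^+ i.
Proof.
move=> sp pd; rewrite (horner_coef_wide a sp) (le_trans (cnorm_sum _ _ _)) // mulr_sumr.
by apply: ler_sum => i _; rewrite cnormM cnormX ler_wpM2r // exprn_ge0 // cnorm_ge0.
Qed.

Lemma prod_small m (x : 'I_m.+1 -> R) (e : R) : 0 <= e ->
  \prod_k x k <= e ^+ m.+1 -> exists k, x k <= e.
Proof.
move=> e0 pe; apply: contrapT => nex.
have lt k : e < x k by rewrite ltNge; apply/negP => h; apply: nex; exists k.
suff : e ^+ m.+1 < \prod_k x k by rewrite ltNge pe.
rewrite -[e ^+ _]mul1r -{1}[m.+1]card_ord -prodr_const mul1r.
by apply: ltr_prod => [|k _]; [apply/hasP; exists ord0; rewrite ?mem_index_enum | rewrite e0 lt].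
Qed.

(** Induction on the degree. At a root [a] of the first polynomial the second is small, so some
    [v j] is close to [a]; after division by the two linear factors the quotients are still
    close. *)
Lemma roots_continuous m (u : 'I_m -> C) (e : R) : 0 < e ->
  exists2 d : R, 0 < d & forall v : 'I_m -> C,
    (forall i, cnorm ((roots_poly u)`_i - (roots_poly v)`_i) <= d) ->
    exists s : 'S_m, forall k, cnorm (u k - v (s k)) <= e.
Proof.
move=> e0; elim: m u => [|m IH] u.
  by exists 1 => // v _; exists 1%g => -[].
pose a := u ord0; pose P := roots_poly (fun k => u (lift ord0 k)).
have [d1 d10 Hd1] := IH (fun k => u (lift ord0 k)).
pose Pn := coef_norm P; have Pn0 : 0 <= Pn := coef_norm_ge0 P.
(* The loss in dividing by ['X - (v j)%:P], whose root has modulus at most [cnorm a + 1] because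
   [eta <= 1]. *)
pose M := (1 + (cnorm a + 1)) ^+ m.
have M0 : 0 < M by rewrite exprn_gt0 //; have := cnorm_ge0 a; lra.
pose A : R := \sum_(i < m.+2) cnorm a ^+ i.
have A0 : 0 < A.
  rewrite /A big_ord_recl expr0 ltr_pwDl // sumr_ge0 // => i _.
  by rewrite exprn_ge0 // cnorm_ge0.
pose eta := Num.min e (Num.min 1 (d1 / 2 / M / (Pn + 1))).
have eta0 : 0 < eta by rewrite !lt_min e0 ltr01 !divr_gt0 //; lra.
have [etae [eta1 etaM]] : eta <= e /\ eta <= 1 /\ eta <= d1 / 2 / M / (Pn + 1).
  by rewrite /eta !ge_min !lexx !orbT.
(* The second bound makes one of the [m.+1] factors [a - v k] at most [eta]. The perturbation [d]
   and the shift [eta] then each cost at most [d1 / 2] in the quotient. *)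
pose d := Num.min (d1 / 2 / M) (eta ^+ m.+1 / A).
have d0 : 0 < d by rewrite lt_min !divr_gt0 // exprn_gt0.
have [dM dA] : d <= d1 / 2 / M /\ d <= eta ^+ m.+1 / A.
  by rewrite /d !ge_min !lexx !orbT.
exists d => // v Hv.
have Eu : roots_poly u = ('X - a%:P) * P by rewrite /roots_poly big_ord_recl.
have [j Hj] : exists j, cnorm (a - v j) <= eta.
  apply: prod_small (ltW eta0) _; rewrite -cnorm_prod.
  have -> : \prod_k (a - v k) = (roots_poly v - roots_poly u).[a].
    rewrite hornerD hornerN Eu hornerM hornerXsubC subrr mul0r subr0 horner_prod.
    by apply: eq_bigr => k _; rewrite hornerXsubC.
  apply: le_trans (horner_bound (m := m.+2) (d := d) a _ _) _.
  - by rewrite (leq_trans (size_polyD _ _)) // size_polyN !size_roots_poly maxnn.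
  - by move=> i; rewrite coefB cnormBC Hv.
  - by rewrite -ler_pdivlMr.
pose Q := roots_poly (fun k => v (lift j k)).
have Ev : roots_poly v = ('X - (v j)%:P) * Q by rewrite /roots_poly (@bigD1_ord _ _ _ _ j xpredT).
have [|s Hs] := Hd1 (fun k => v (lift j k)); last first.
  exists (lift_perm ord0 j s) => k; case: (unliftP ord0 k) => [k' ->|->].
    by rewrite lift_perm_lift Hs.
  by rewrite lift_perm_id (le_trans Hj).
move=> i; rewrite -/P -/Q -coefB.
have bB : cnorm (v j) <= cnorm a + 1.
  have := cnorm_tri (v j) a 0; rewrite !subr0 cnormBC; lra.
have sPQ : (size (P - Q)%R <= m.+1)%N.
  by rewrite (leq_trans (size_polyD _ _)) // size_polyN !size_roots_poly maxnn.
(* Both quotients are monic of degree [m], so their difference has smaller degree, as the exponent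
   in [M] requires. *)
have sPQ' : (size (P - Q)%R <= m)%N.
  rewrite -ltnS ltn_neqAle sPQ andbT; apply/eqP => E.
  have : lead_coef (P - Q) = 0.
    rewrite lead_coefE E /= coefB.
    have mon (t : 'I_m -> C) : (roots_poly t)`_m = 1 :> C.
      have := lead_coef_prod_XsubC (index_enum 'I_m) xpredT t.
      by rewrite lead_coefE -/(roots_poly t) size_roots_poly.
    by rewrite !mon subrr.
  by move/eqP; rewrite lead_coef_eq0 -size_poly_eq0 E.
have g i' : cnorm ((('X - (v j)%:P) * (P - Q))`_i') <= d + eta * Pn.
  have -> : ('X - (v j)%:P) * (P - Q) =
      (roots_poly u - roots_poly v) + (a - v j) *: P.
    by rewrite Eu Ev -mul_polyC polyCB; ring.
  rewrite coefD coefB coefZ (le_trans (cnormD _ _)) // lerD // cnormM.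
  by rewrite ler_pM // ?cnorm_ge0 ?le_coef_norm.
apply: le_trans (coef_divXsubC_bound sPQ' bB g i) _; rewrite -/M.
have h1 : M * d <= d1 / 2 by rewrite mulrC -ler_pdivlMr.
have h2 : M * (eta * Pn) <= d1 / 2.
  rewrite mulrA mulrAC.
  have : eta * (Pn + 1) <= d1 / 2 / M by rewrite -ler_pdivlMr //; lra.
  rewrite ler_pdivlMr // => h.
  have := mulr_gt0 M0 eta0; lra.
by rewrite mulrDr; lra.
Qed.

End RootContinuity.

(** * Matching roots along a path of polynomials *)

Section Homotopy.
Context {R : realType}.
Local Notation C := R[i].

Lemma path_cnorm (T : eqType) (x : T -> C) (D : R) (e : rel T) i p :
  (forall i j, e i j -> cnorm (x i - x j) <= D) -> path e i p ->
  cnorm (x i - x (last i p)) <= (size p)%:R * D.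
Proof.
move=> eD; elim: p i => [|j p IH] i /=; first by rewrite subrr cnorm0 mul0r.
case/andP=> /eD eij /IH h; rewrite (le_trans (cnorm_tri _ (x j) _)) //.
by rewrite -add1n natrD mulrDl mul1r lerD.
Qed.

Lemma connect_cnorm (T : finType) (x : T -> C) (D : R) (e : rel T) i j : 0 <= D ->
  (forall i j, e i j -> cnorm (x i - x j) <= D) -> connect e i j ->
  cnorm (x i - x j) <= #|T|%:R * D.
Proof.
move=> D0 eD /connectP[p ep ->]; case/shortenP: ep => p' ep' up' _.
apply: le_trans (path_cnorm eD ep') _; rewrite ler_wpM2r // ler_nat.
by have := max_card (mem (i :: p')); rewrite (card_uniqP up') => /ltnW.
Qed.

(* The roots of p s are tracked along [0, 1]: steps of length at most 1 inside
   the r-neighbourhood of the points u k stay within one component of the graph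
   joining points at distance at most 2 r + 1. *)
Lemma homotopy_matching m (u : 'I_m -> C) (p : R -> {poly C}) (r M : R) :
  0 <= r -> 0 <= M -> p 0 = roots_poly u ->
  (forall s, 0 <= s <= 1 -> exists v : 'I_m -> C, p s = roots_poly v) ->
  (forall s t i, 0 <= s <= 1 -> 0 <= t <= 1 ->
     cnorm ((p s)`_i - (p t)`_i) <= M * `|s - t|) ->
  (forall s w, 0 <= s <= 1 -> root (p s) w -> exists k, cnorm (w - u k) <= r) ->
  forall v : 'I_m -> C, p 1 = roots_poly v ->
  exists sg : 'S_m, forall k,
    cnorm (u k - v (sg k)) <= m%:R * (2 * r + 1) + r + 1.
Proof.
move=> r0 M0 p0 pv plip pnear v1 pv1.
pose e := [rel i j : 'I_m | cnorm (u i - u j) <= 2 * r + 1].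
(* The index matters: [v k] has to stay near the component of [k] itself, which turns a listing of
   the roots into a matching with [u]. *)
pose near_comp (v : 'I_m -> C) := forall k, exists2 j, connect e k j & cnorm (v k - u j) <= r.
pose G s := exists2 v : 'I_m -> C, p s = roots_poly v & near_comp v.
have rootv s (v : 'I_m -> C) k : p s = roots_poly v -> root (p s) (v k).
  move=> ->; rewrite /root horner_prod (bigD1 k) //= hornerXsubC subrr mul0r.
  exact: eqxx.
have move_comp s (v w : 'I_m -> C) : 0 <= s <= 1 -> p s = roots_poly w ->
    near_comp v -> (forall k, cnorm (v k - w k) <= 1) -> near_comp w.
  move=> s01 pw nv vw k; have [j kj vj] := nv k.
  have [j' wj'] := pnear s (w k) s01 (rootv _ _ _ pw).
  exists j' => //; apply: connect_trans kj (connect1 _) => /=.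
  have := cnorm_tri (u j) (v k) (u j'); have := cnorm_tri (v k) (w k) (u j').
  have := vw k; have := cnormBC (u j) (v k); lra.
have roots_perm (v : 'I_m -> C) (sg : 'S_m) : roots_poly (v \o sg) = roots_poly v.
  by rewrite /roots_poly [RHS](reindex_inj (@perm_inj _ sg)).
have loc s (v : 'I_m -> C) : 0 <= s <= 1 -> p s = roots_poly v -> exists2 d : R, 0 < d &
    forall t (w : 'I_m -> C), 0 <= t <= 1 -> `|s - t| <= d -> p t = roots_poly w ->
    exists sg : 'S_m, forall k, cnorm (v k - w (sg k)) <= 1.
  move=> s01 ps; have [d d0 Hd] := roots_continuous v (@ltr01 R).
  exists (d / (M + 1)) => [|t w t01 st pt]; first by rewrite divr_gt0 //; lra.
  apply: Hd => i; rewrite -ps -pt; apply: le_trans (plip _ _ _ s01 t01) _.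
  move: st; rewrite ler_pdivlMr; last by lra.
  by have := normr_ge0 (s - t); lra.
(* [fwd] says that [G] is open in [0, 1], and [bwd] that it is closed. *)
have fwd s : 0 <= s <= 1 -> G s -> exists2 d : R, 0 < d &
    forall t, 0 <= t <= 1 -> `|s - t| <= d -> G t.
  move=> s01 [v ps nv]; have [d d0 Hd] := loc s v s01 ps.
  exists d => // t t01 st; have [w pw] := pv t t01.
  have [sg Hsg] := Hd t w t01 st pw.
  have pw' : p t = roots_poly (w \o sg) by rewrite roots_perm.
  by exists (w \o sg) => //; apply: move_comp t01 pw' nv Hsg.
have bwd s : 0 <= s <= 1 -> exists2 d : R, 0 < d &
    forall t, 0 <= t <= 1 -> `|s - t| <= d -> G t -> G s.
  move=> s01; have [v ps] := pv s s01; have [d d0 Hd] := loc s v s01 ps.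
  exists d => // t t01 st [w pw nw]; have [sg Hsg] := Hd t w t01 st pw.
  have pv' : p s = roots_poly (v \o (sg^-1)%g) by rewrite roots_perm.
  exists (v \o (sg^-1)%g) => //; apply: move_comp s01 pv' nw _ => k /=.
  by have := Hsg ((sg^-1)%g k); rewrite permKV cnormBC.
have G0 : G 0.
  by exists u => // k; exists k; rewrite ?connect0 // subrr cnorm0.
(* Connectedness of [0, 1] by suprema: [sup E] satisfies [G] by [bwd] and equals 1 by [fwd]. *)
pose E : set R := [set s | 0 <= s <= 1 /\ G s]%classic.
have E0 : E 0 by split=> //; rewrite lexx ler01.
have Eub : ubound E 1 by move=> s [/andP[]].
have nE : (E !=set0)%classic by exists 0.
have Esup : has_sup E by split; [exists 0 | exists 1].
have sup01 : 0 <= sup E <= 1.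
  by apply/andP; split; [apply: ub_le_sup E0; exists 1 | apply: ge_sup Eub].
have Gsup : G (sup E).
  have [d d0 Hd] := bwd _ sup01; have [t [t01 Gt] dt] := sup_adherent d0 Esup.
  have tE : t <= sup E by apply: (ub_le_sup (ex_intro _ 1 Eub)); split.
  by apply: Hd t01 _ Gt; rewrite ger0_norm ?subr_ge0 //; lra.
have sup1 : sup E = 1.
  have [d d0 Hd] := fwd _ sup01 Gsup.
  apply/eqP; rewrite eq_le; case/andP: (sup01) => s0 -> /=.
  rewrite leNgt; apply/negP => s1; pose t := Num.min 1 (sup E + d).
  have [ts tle] : sup E < t /\ t <= sup E + d by rewrite /t lt_min s1 ge_min lexx orbT ltrDl.
  have t01 : 0 <= t <= 1 by rewrite (le_trans s0 (ltW ts)) /t ge_min lexx.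
  have : E t by split=> //; apply: Hd => //; rewrite ler0_norm; lra.
  move=> /(ub_le_sup (ex_intro _ 1 Eub)); lra.
rewrite sup1 in Gsup sup01; have [v pv' nv] := Gsup.
(* [v] and [v1] list the same roots in possibly different orders. Using [loc] at distance 0 to align
   them yields the last summand 1 of the bound. *)
have [d d0 Hd] := loc 1 v sup01 pv'.
have [|sg Hsg] := Hd 1 v1 sup01 _ pv1; first by rewrite subrr normr0 ltW.
exists sg => k; have [j kj vj] := nv k.
have : cnorm (u k - u j) <= #|'I_m|%:R * (2 * r + 1).
  by apply: connect_cnorm kj => [|//]; lra.
rewrite card_ord => ukj.
have := cnorm_tri (u k) (u j) (v1 (sg k)); have := cnorm_tri (u j) (v k) (v1 (sg k)).
have := Hsg k; have := cnormBC (u j) (v k); lra.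
Qed.

End Homotopy.

(** * Finite bounds on the root distances *)

Section Distances.
Context {R : realType}.
Local Notation C := R[i].
Implicit Types (f g : {poly C}) (s t : seq C) (r : R).

Lemma bigmin_leP (I : eqType) (q : seq I) (F : I -> \bar R) r :
  (\big[Order.min/+oo%E]_(x <- q) F x <= r%:E)%E <-> exists2 x, x \in q & (F x <= r%:E)%E.
Proof.
elim: q => [|a q IH]; first by rewrite big_nil leye_eq; split=> // -[].
rewrite big_cons ge_min; split.
  case/orP=> [h|/IH[x xq h]]; first by exists a; rewrite ?mem_head.
  by exists x; rewrite ?inE ?xq ?orbT.
case=> x; rewrite inE => /orP[/eqP->-> //|xq h].
by apply/orP; right; apply/IH; exists x.
Qed.

Lemma bigmax_leP (I : eqType) (q : seq I) (F : I -> \bar R) r : 0 <= r ->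
  (\big[Order.max/0%E]_(x <- q) F x <= r%:E)%E <-> forall x, x \in q -> (F x <= r%:E)%E.
Proof.
move=> r0; elim: q => [|a q IH]; first by rewrite big_nil lee_fin r0; split.
rewrite big_cons ge_max; split.
  by case/andP=> h /IH hq x; rewrite inE => /orP[/eqP->|/hq].
move=> h; rewrite h ?mem_head //=; apply/IH => x xq.
by apply: h; rewrite inE xq orbT.
Qed.

Lemma dm_seq_leP s t r : (dm_seq s t <= r%:E)%E <->
  exists x y, [/\ x \in s, y \in t & cnorm (x - y) <= r].
Proof.
split=> [/bigmin_leP[x xs /bigmin_leP[y yt]]|[x [y [xs yt h]]]].
  by rewrite lee_fin => h; exists x, y.
by apply/bigmin_leP; exists x => //; apply/bigmin_leP; exists y.
Qed.

Lemma dh_seq_leP s t r : 0 <= r -> (dh_seq s t <= r%:E)%E <->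
  forall y, y \in t -> exists2 x, x \in s & cnorm (x - y) <= r.
Proof.
move=> r0; split=> [/(bigmax_leP _ _ r0) h y /h/bigmin_leP[x xs]|h].
  by rewrite lee_fin; exists x.
by apply/bigmax_leP => // y /h[x xs xy]; apply/bigmin_leP; exists x.
Qed.

Lemma d_F_leP s t r : 0 <= r -> (d_F s t <= r%:E)%E <->
  exists sg : 'S_(size s), forall k : 'I_(size s), cnorm (s`_k - t`_(sg k)) <= r.
Proof.
move=> r0; split=> [/bigmin_leP[sg _ /(bigmax_leP _ _ r0) h]|[sg h]].
  by exists sg => k; have := h k (mem_index_enum k); rewrite lee_fin.
apply/bigmin_leP; exists sg; first exact: mem_index_enum.
by apply/bigmax_leP => // k _; rewrite lee_fin.
Qed.

Lemma sup_lty_bounded (T : Type) (A : set T) (d : T -> \bar R) :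
  (ereal_sup [set d x | x in A]%classic < +oo)%E <->
  exists2 r, 0 <= r & forall x, A x -> (d x <= r%:E)%E.
Proof.
split=> [|[r r0 h]]; last first.
  apply: le_lt_trans (ltry r); apply: ge_ereal_sup => _ [x Ax <-]; exact: h.
have ub x : A x -> (d x <= ereal_sup [set d x | x in A]%classic)%E.
  by move=> Ax; apply: ereal_sup_ubound; exists x.
case: (ereal_sup _) ub => [r| |] ub // _.
  exists (Num.max r 0) => [|x Ax]; first by rewrite le_max lexx orbT.
  by rewrite (le_trans (ub x Ax)) // lee_fin le_max lexx.
by exists 0 => // x Ax; rewrite (le_trans (ub x Ax)) // leNye.
Qed.

(** Size 1 means an empty root set, and infinite distance arises when exactly one root set is empty.
    The zero polynomial, of size 0, is covered because its distance to a nonempty root set is 0. *)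
Lemma dist_ext_leP d f g r : 0 <= r ->
  (dist_ext d (Zopt f) (Zopt g) <= r%:E)%E <->
  (size f == 1%N) = (size g == 1%N) /\
  ((1 < size f)%N -> (1 < size g)%N -> (d (rootsC f) (rootsC g) <= r%:E)%E).
Proof.
move=> r0; rewrite /Zopt.
have sz (h : {poly C}) : h != 0 -> size h = (size (rootsC h)).+1.
  move=> h0; case: (size_rootsC h) => [->|/eqP]; last by rewrite (negPf h0).
  by rewrite prednK // size_poly_gt0.
have [->|/sz ->] := eqVneq f 0; have [->|/sz ->] := eqVneq g 0;
  rewrite ?size_poly0 /= ?lee_fin.
- by split.
- by case: (rootsC g) => [|y t] /=; rewrite ?lee_fin; split=> // -[].
- by case: (rootsC f) => [|x s] /=; rewrite ?lee_fin; split=> // -[].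
- case: (rootsC f) (rootsC g) => [|x s] [|y t] /=; rewrite ?lee_fin; split=> //.
  + by case.
  + by case.
  + by case=> _; apply.
Qed.

End Distances.

(** * Comparing the constants, and Grace operators *)

Section Operators.
Context {R : realType}.
Local Notation C := R[i].
Variables (n : nat) (T : {linear {poly C} -> {poly C}}).

Definition unit_diffop : Prop :=
  exists2 c : nat -> C, c 0%N != 0 & forall f, inPn n f -> T f = diffop c n f.

Lemma K_lty (K : (seq C -> seq C -> \bar R)) :
  (ereal_sup [set dist_ext K (Zopt f) (Zopt (T f)) | f in [set f | inPn n f]]%classic < +oo)%E
  <-> exists2 r : R, 0 <= r & forall f, inPn n f ->
    (size f == 1%N) = (size (T f) == 1%N) /\
    ((1 < size f)%N -> (1 < size (T f))%N -> (K (rootsC f) (rootsC (T f)) <= r%:E)%E).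
Proof.
split=> [/(sup_lty_bounded _ _)|] [r r0 h].
  by exists r => // f fn; apply/(dist_ext_leP _ _ _ r0)/h.
by apply/sup_lty_bounded; exists r => // f fn; apply/(dist_ext_leP _ _ _ r0)/h.
Qed.

Lemma K_h_K_m : (K_h n T < +oo)%E -> (K_m n T < +oo)%E.
Proof.
case/K_lty=> r r0 h; apply/K_lty; exists r => // f fn.
have [e hf] := h f fn; split=> // sf sTf.
have [T0 sT] : T f != 0 /\ size (T f) != 1%N.
  by rewrite -size_poly_eq0; case: (size (T f)) sTf => [|[]].
have [y Ty] := closed_rootP (T f) sT.
have /(dh_seq_leP _ _ r0)/(_ y) := hf sf sTf; rewrite mem_rootsC // => /(_ Ty)[x xf xy].
by apply/dm_seq_leP; exists x, y; split=> //; rewrite mem_rootsC.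
Qed.

Lemma K_H_K_h : (K_H n T < +oo)%E -> (K_h n T < +oo)%E.
Proof.
case/K_lty=> r r0 h; apply/K_lty; exists r => // f fn.
have [e hf] := h f fn; split=> // sf sTf.
by have := hf sf sTf; rewrite /dH_seq ge_max => /andP[].
Qed.

Lemma K_F_K_H : deg_preserving n T -> (K_F n T < +oo)%E -> (K_H n T < +oo)%E.
Proof.
move=> deg /sup_lty_bounded[r r0 h]; apply/K_lty; exists r => // f fn.
rewrite deg //; split=> // sf _.
have f0 : f != 0 by rewrite -size_poly_eq0; case: (size f) sf.
have Tf0 : T f != 0 by rewrite -size_poly_eq0 deg // size_poly_eq0.
have ss : size (rootsC (T f)) = size (rootsC f).
  case: (size_rootsC f) => [->|/eqP]; last by rewrite (negPf f0).
  by case: (size_rootsC (T f)) => [->|/eqP]; [rewrite deg | rewrite (negPf Tf0)].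
have /(d_F_leP _ _ r0)[sg Hsg] := h f (conj fn sf).
rewrite /dH_seq ge_max; apply/andP; split; apply/dh_seq_leP => // y /(nthP 0)[j].
  rewrite ss => iy <-; pose k := (sg^-1)%g (Ordinal iy).
  exists (rootsC f)`_k; first by rewrite mem_nth.
  by have := Hsg k; rewrite permKV.
move=> iy <-; exists (rootsC (T f))`_(sg (Ordinal iy)); first by rewrite mem_nth // ss.
by rewrite cnormBC; apply: (Hsg (Ordinal iy)).
Qed.

Lemma unit_diffop_grace : unit_diffop -> grace_op n T.
Proof.
case=> c c0 Tc; exists (diffop_zeros c n n) => f fn f0 Om cOm AOm w.
rewrite /Zset /= Tc // => Tw; have [m sf] : exists m, size f = m.+1.
  by exists (size f).-1; rewrite prednK // size_poly_gt0.
have mn : (m <= n)%N by move: fn; rewrite /inPn sf.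
have [a|u [fu Ou]] := diffop_grace c0 sf cOm _ Tw.
  by move=> ra; apply: AOm; apply: mem_diffop_zeros ra.
by exists u, (w - u); do 2!split=> //; rewrite addrCA subrr addr0.
Qed.

(** A closed disk about 0 containing [A] puts each root of [T f] within [r] of a root of [f]. What
    remains is that [f] and [T f] are nonzero constants simultaneously, which rests on the
    injectivity of [T]. *)
Lemma grace_K_h : grace_op n T -> (K_h n T < +oo)%E.
Proof.
case=> A HA; have [r r0 Hr] := seq_cnorm_bound A.
have near f w : inPn n f -> f != 0 -> root (T f) w -> exists2 u, root f u & cnorm (w - u) <= r.
  move=> fn f0 Tw.
  have cd : circular_domain (fun z : C => is_true (cnorm (z - 0) <= r)).
    by left; exists 0, r; split=> //; apply: Or42.
  have [a aA|u [v [fu [rv ->]]]] := HA f fn f0 _ cd _ w Tw; first by rewrite subr0 Hr.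
  by exists u => //; rewrite addrC addKr -(subr0 v).
have T0 f : inPn n f -> f != 0 -> T f != 0.
  move=> fn f0; apply/eqP => Tf0.
  have [B B0 HB] := seq_cnorm_bound (rootsC f).
  (* If [T f = 0] every point is a root of it, including this one, which is farther than [r] from
     all roots of [f]. *)
  have [|u fu] := near f (B + r + 1)%:C%C fn f0; first by rewrite Tf0 root0.
  have := HB u; rewrite mem_rootsC // => /(_ fu) uB.
  have := cnorm_tri (B + r + 1)%:C%C u 0; rewrite !subr0 cnorm_real; lra.
have noroot f : inPn n f -> size f = 1%N -> size (T f) == 1%N.
  move=> fn sf; apply/negPn/negP => /closed_rootP[w Tw].
  have f0 : f != 0 by rewrite -size_poly_eq0 sf.
  have [u] := near f w fn f0 Tw.
  by move/eqP: sf => /size_poly1P[a a0 ->]; rewrite rootC (negPf a0).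
apply/K_lty; exists r; first exact: ltW.
move=> f fn; split; last first.
  move=> sf sTf; have f0 : f != 0 by rewrite -size_poly_eq0; case: (size f) sf.
  apply/dh_seq_leP => [|y]; first exact: ltW.
  rewrite mem_rootsC ?T0 // => /(near f y fn f0)[u fu uy].
  by exists u; rewrite ?mem_rootsC // cnormBC.
apply/eqP/eqP => [/(noroot f fn)/eqP //|/eqP/size_poly1P[b b0 Tb]].
have one : inPn n (1 : {poly C}) by rewrite /inPn size_poly1.
have := noroot 1 one (size_poly1 _); case/size_poly1P=> a a0 Ta.
(* If [T f] is constant, so is [f]: subtracting the constant with the same image leaves an element
   of the kernel. *)
have E : T (f - (b / a) *: 1) = 0.
  by rewrite linearB linearZ /= Ta Tb -mul_polyC -polyCM divfK // subrr.
have : f - (b / a) *: 1 == 0.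
  apply/negPn/negP => nz; suff /T0/(_ nz) : inPn n (f - (b / a) *: 1) by rewrite E eqxx.
  rewrite /inPn (leq_trans (size_polyD _ _)) // geq_max size_polyN [(size f <= _)%N]fn /=.
  by rewrite (leq_trans (size_scale_leq _ _)) // size_poly1.
rewrite subr_eq0 => /eqP ->; rewrite size_scale ?size_poly1 //.
by rewrite mulf_neq0 // invr_neq0.
Qed.

End Operators.

(** * Recovering the differential operator, and its consequences *)

Section UnitDiffop.
Context {R : realType}.
Local Notation C := R[i].
Variables (n : nat) (T : {linear {poly C} -> {poly C}}).

(** At distance at least [x >= 1] from all its roots, a nonconstant [q] has modulus at least the
    leading modulus times [x]. *)
Lemma poly_bounded_const (q : {poly C}) (r M : R) : 0 <= r -> 0 <= M ->
  (forall a, exists2 y, cnorm (a - y) <= r & cnorm q.[y] <= M) -> (size q <= 1)%N.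
Proof.
move=> r0 M0 H; rewrite leqNgt; apply/negP => sq.
have q0 : q != 0 by rewrite -size_poly_eq0; case: (size q) sq.
have [B B0 HB] := seq_cnorm_bound (rootsC q).
pose L := cnorm (lead_coef q).
have L0 : 0 < L.
  rewrite lt_def cnorm_ge0 andbT; apply: contraNneq q0 => /cnorm0_eq0/eqP.
  by rewrite lead_coef_eq0.
pose x := M / L + 1; have x1 : 1 <= x by rewrite lerDr divr_ge0 // ltW.
(* The roots have modulus at most [B], so any [y] within [r] of this center is at least [x] away
   from each of them. *)
have [y ay qy] := H (B + r + x)%:C%C.
have far z : z \in rootsC q -> x <= cnorm (y - z).
  move=> /HB zB; have := cnorm_tri (B + r + x)%:C%C y 0; have := cnorm_tri y z 0.
  rewrite !subr0 cnorm_real; lra.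
have ge1 s : (forall z, z \in s -> x <= cnorm (y - z)) -> 1 <= \prod_(z <- s) cnorm (y - z).
  elim: s => [|z s IH] sx; first by rewrite big_nil.
  rewrite big_cons mulr_ege1 //; first by rewrite (le_trans x1) // sx ?mem_head.
  by apply: IH => t ts; apply: sx; rewrite inE ts orbT.
move: qy; rewrite [q in q.[_]](rootsC_prod q) hornerZ cnormM -/L horner_prod cnorm_prod.
under eq_bigr => z _ do rewrite hornerXsubC.
case: (size_rootsC q) => [|/eqP]; last by rewrite (negPf q0).
case: (rootsC q) far => [|z s] far ss.
  by move: sq; rewrite -[size q]prednK ?size_poly_gt0 // -ss.
rewrite big_cons leNgt => /negP; apply.
have p1 := ge1 s (fun t ts => far t (mem_behead (s := z :: s) ts)).
have zx := far z (mem_head _ _).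
have h : x <= cnorm (y - z) * \prod_(t <- s) cnorm (y - t).
  by rewrite (le_trans zx) // ler_peMr ?cnorm_ge0.
rewrite (lt_le_trans (_ : M < L * x)) ?ler_wpM2l ?(ltW L0) //.
by rewrite /x mulrDr mulrCA divff ?gt_eqF // !mulr1 ltrDl.
Qed.

Lemma poly_split_lead k (f : {poly C}) : (size f <= k.+1)%N ->
  exists2 g, f = f`_k *: 'X^k + g & (size g <= k)%N.
Proof.
move=> fk; exists (f - f`_k *: 'X^k); first by rewrite addrC subrK.
apply/leq_sizeP => j kj; rewrite coefB coefZ coefXn.
have [->|jk] := eqVneq j k; first by rewrite mulr1 subrr.
by rewrite mulr0 subr0 nth_default // (leq_trans fk) // ltn_neqAle eq_sym jk.
Qed.

(* The error q of T against the operator found so far is read off T ('X - a)^k,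
   which vanishes within r of a; so q is bounded near every point a. *)
Lemma K_m_unit_diffop : (K_m n T < +oo)%E -> unit_diffop n T.
Proof.
case/K_lty=> r r0 HT.
have near f : inPn n f -> (1 < size f)%N ->
    exists x y, [/\ root f x, root (T f) y & cnorm (x - y) <= r].
  move=> fn sf; have [e h] := HT f fn.
  have f0 : f != 0 by rewrite -size_poly_eq0; case: (size f) sf.
  (* When [T f = 0], any root of [f] serves as both points. *)
  have [Tf0|Tf0] := eqVneq (T f) 0.
    have sf1 : size f != 1%N by case: (size f) sf => [|[]].
    have [x fx] := closed_rootP f sf1.
    by exists x, x; rewrite Tf0 root0 subrr cnorm0.
  have sTf : (1 < size (T f))%N.
    move: e Tf0; rewrite -size_poly_eq0; case: (size f) sf => [|[|?]] // _.
    by case: (size (T f)) => [|[]].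
  have /dm_seq_leP[x [y [xf yT xy]]] := h sf sTf.
  by exists x, y; rewrite -!mem_rootsC.
suff [c c0 Tc] : exists2 c : nat -> C, c 0%N != 0 &
    forall f : {poly C}, (size f <= n.+1)%N -> T f = diffop c n f by exists c.
(* Induction on the degree bound [k], at most [n]. In the base case [T 1] is a nonzero constant,
   since otherwise exactly one of the two root sets would be empty. *)
have : (n <= n)%N by []; move: {1 3 4}n; elim=> [|k IH] kn.
  have [|e _] := HT 1; first by rewrite /inPn size_poly1.
  move: e; rewrite size_poly1 eqxx => /esym/size_poly1P[a a0 Ta].
  exists (fun=> a) => // f /size1_polyC ->.
  by rewrite /diffop big_ord1 derivn0 -alg_polyC !linearZ /= Ta -alg_polyC !scalerA mulrC.
have [c c0 Tc] := IH (ltnW kn).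
pose q := T 'X^(k.+1) - diffop c k 'X^(k.+1).
have Tq (f : {poly C}) : (size f <= k.+2)%N -> T f = diffop c k f + f`_k.+1 *: q.
  move=> fk; have [g fg gk] := poly_split_lead fk.
  move: (f`_k.+1) fg => b ->.
  rewrite linearP diffop_is_linear (Tc g gk) /q scalerBr.
  by move: (b *: T _) (b *: diffop _ _ _) (diffop _ _ g) => x y z; ring.
pose p := diffop c k 'X^(k.+1).
have sXa (a : C) : size (('X - a%:P) ^+ k.+1) = k.+2 :> nat by rewrite size_exp_XsubC.
have sq : (size q <= 1)%N.
  pose M := coef_norm p * \sum_(i < size p) r ^+ i.
  apply: (poly_bounded_const r0 (M := M)) => [|a].
    by rewrite mulr_ge0 ?coef_norm_ge0 // sumr_ge0 // => i _; rewrite exprn_ge0.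
  have [||x [y []]] := near (('X - a%:P) ^+ k.+1); rewrite /inPn ?sXa //.
  rewrite rootE horner_exp hornerXsubC expf_eq0 /= subr_eq0 => /eqP -> Ty ay.
  exists y => //; move: Ty; rewrite rootE Tq ?sXa //.
  have -> : (('X - a%:P) ^+ k.+1)`_k.+1 = 1.
    have := lead_coef_exp ('X - a%:P) k.+1.
    by rewrite lead_coefE sXa lead_coefXsubC expr1n.
  rewrite scale1r -comp_Xn_poly diffop_comp_XsubC hornerD horner_comp hornerXsubC -/p.
  rewrite addrC addr_eq0 => /eqP ->; rewrite cnormN.
  apply: le_trans (horner_bound (y - a) (leqnn _) (le_coef_norm p)) _.
  rewrite /M ler_wpM2l ?coef_norm_ge0 //; apply: ler_sum => i _.
  by rewrite lerXn2r ?nnegrE ?cnorm_ge0 // cnormBC.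
(* The factorial compensates for the derivative of order [k.+1] of ['X^(k.+1)]. *)
pose c' i := if i == k.+1 then q`_0 / (k.+1)`!%:R else c i.
exists c' => // f fk; rewrite Tq // /diffop [RHS]big_ord_recr; congr (_ + _).
  apply: eq_bigr => i _; rewrite /c' ifF //=.
  by apply/eqP => ik; have := ltn_ord i; rewrite ik ltnn.
change (f`_k.+1 *: q = c' k.+1 *: f^`(k.+1)); rewrite /c' eqxx (size1_polyC sq).
have F0 : (k.+1)`!%:R != 0 :> C by rewrite pnatr_eq0 -lt0n fact_gt0.
have -> : f^`(k.+1) = (f`_k.+1 * (k.+1)`!%:R)%:P.
  apply/polyP => i; rewrite coef_derivn coefC; case: i => [|i].
    by rewrite addn0 ffactnn mulr_natr.
  by rewrite nth_default ?mul0rn // (leq_trans fk) // addnS ltnS leq_addr.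
by rewrite -!mul_polyC -!polyCM coefC /= mulrCA divfK // mulrC.
Qed.

(** [T] preserves sizes, so it is injective, and it is surjective by elimination of leading
    terms. *)
Lemma unit_diffop_invertible : unit_diffop n T -> op_invertible n T.
Proof.
case=> c c0 Tc.
have sT f : inPn n f -> size (T f) = size f by move=> fn; rewrite Tc // size_diffop.
have inj f g : inPn n f -> inPn n g -> T f = T g -> f = g.
  move=> fn gn E; apply/eqP; rewrite -subr_eq0 -size_poly_eq0 -sT.
    by rewrite linearB E subrr size_poly0.
  by rewrite /inPn (leq_trans (size_polyD _ _)) // geq_max size_polyN; apply/andP.
have surj m : (m <= n.+1)%N -> forall f : {poly C}, (size f <= m)%N ->
    exists2 g : {poly C}, (size g <= m)%N & T g = f.
  elim: m => [|m IH] mn f fm.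
    by exists 0; rewrite ?size_poly0 // linear0; apply/esym/eqP; rewrite -size_poly_leq0.
  have Xn : inPn n ('X^m : {poly C}) by rewrite /inPn size_polyXn.
  have sX : size (T 'X^m) = m.+1 by rewrite sT // size_polyXn.
  have l0 : (T 'X^m)`_m != 0.
    have := lead_coef_eq0 (T 'X^m); rewrite lead_coefE sX /= => ->.
    by rewrite -size_poly_eq0 sX.
  pose a := f`_m / (T 'X^m)`_m.
  have [|g gm Tg] := IH (ltnW mn) (f - a *: T 'X^m).
    apply/leq_sizeP => j mj; rewrite coefB coefZ.
    have [->|jm] := eqVneq j m; first by rewrite divfK // subrr.
    have jm' : (m.+1 <= j)%N by rewrite ltn_neqAle eq_sym jm.
    by rewrite !nth_default ?mulr0 ?subrr ?sX // (leq_trans fm).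
  exists (g + a *: 'X^m); last by rewrite linearD linearZ /= Tg subrK.
  rewrite (leq_trans (size_polyD _ _)) // geq_max (leq_trans gm) //=.
  by rewrite (leq_trans (size_scale_leq _ _)) // size_polyXn.
have ex f : exists g, inPn n f -> inPn n g /\ T g = f.
  have [fn|] := boolP (inPn n f); last by exists 0.
  by have [g gn Tg] := surj _ (leqnn _) f fn; exists g.
have [S HS] := choice ex.
exists S => f fn; have [Sf TSf] := HS f fn.
have Tfn : inPn n (T f) by rewrite /inPn sT.
by have [STf TSTf] := HS _ Tfn; split=> //; apply: inj.
Qed.

Lemma unit_diffop_span : unit_diffop n T -> in_diff_span n T.
Proof. by case=> c _ Tc; exists c. Qed.

Lemma inPn_deriv (f : {poly C}) : inPn n f -> inPn n f^`().
Proof.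
have [->|f0] := eqVneq f 0; first by rewrite linear0.
by move=> fn; apply: leq_trans (ltnW (lt_size_deriv f0)) fn.
Qed.

Lemma unit_diffop_comm : unit_diffop n T -> commutes_with_D n T.
Proof.
case=> c _ Tc f fn; rewrite !Tc ?inPn_deriv //.
by rewrite /diffop linear_sum; apply: eq_bigr => k _ /=; rewrite linearZ /= -derivSn -derivnS.
Qed.

Lemma span_invertible_unit_diffop :
  in_diff_span n T -> op_invertible n T -> unit_diffop n T.
Proof.
case=> c Tc [S HS].
pose c' k := c (inord k).
have Tc' f : inPn n f -> T f = diffop c' n f.
  by move=> fn; rewrite Tc //; apply: eq_bigr => k _; rewrite /c' inord_val.
exists c' => //; apply/eqP => c0.
have n1 : inPn n (1 : {poly C}) by rewrite /inPn size_poly1.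
have n0 : inPn n (0 : {poly C}) by rewrite /inPn size_poly0.
have T1 : T 1 = 0 by rewrite (Tc' 1 n1) diffop1 c0.
have [_ S1 _] := HS 1 n1; have [_ S0 _] := HS 0 n0.
by move/eqP: S1; rewrite T1 -(linear0 T) S0 eq_sym oner_eq0.
Qed.

(** By induction on the degree, [T f] and the candidate operator at [f] have the same derivative;
    the choice of [c] makes their constant terms agree on monomials. *)
Lemma comm_span : commutes_with_D n T -> in_diff_span n T.
Proof.
move=> TD; pose c k : C := (T 'X^k)`_0 / k`!%:R.
suff H m (f : {poly C}) : (size f <= m)%N -> inPn n f -> T f = diffop c n f.
  by exists c => f fn; rewrite (H _ _ (leqnn _)).
elim: m f => [|m IH] f fm fn.
  by move: fm; rewrite size_poly_leq0 => /eqP->; rewrite diffop0 linear0.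
have f'n : inPn n f^`() by apply: inPn_deriv.
have f'm : (size f^`() <= m)%N.
  have [->|f0] := eqVneq f 0; first by rewrite linear0 size_poly0.
  by rewrite -ltnS (leq_trans _ fm) // lt_size_deriv.
have D : (T f)^`() = (diffop c n f)^`().
  rewrite -TD // IH // /diffop linear_sum; apply: eq_bigr => k _ /=.
  by rewrite linearZ /= -derivSn -derivnS.
apply/polyP => -[|i]; last first.
  have /eqP := congr1 (fun p : {poly C} => p`_i) D; rewrite !coef_deriv eqr_pMn2r //.
  by move/eqP.
rewrite /diffop coef_sum -{1}(coefK f) poly_def linear_sum coef_sum.
rewrite (big_ord_widen n.+1 (fun i => (T (f`_i *: 'X^i))`_0)) // big_mkcond.
apply: eq_bigr => k _; rewrite coefZ coef_derivn addn0 ffactnn -[f`_k *+ _]mulr_natr /c.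
have F0 : k`!%:R != 0 :> C by rewrite pnatr_eq0 -lt0n fact_gt0.
case: ltnP => kf; last by rewrite (nth_default 0 kf) mul0r mulr0.
by rewrite linearZ coefZ mulrC [f`_k * _]mulrC mulrA divfK.
Qed.

Lemma exprn_lipschitz (s t : R) k : 0 <= s <= 1 -> 0 <= t <= 1 ->
  `|s ^+ k - t ^+ k| <= k%:R * `|s - t|.
Proof.
move=> /andP[s0 s1] /andP[t0 t1]; elim: k => [|k IH].
  by rewrite !expr0 subrr normr0 mul0r.
rewrite !exprS (_ : _ - _ = s * (s ^+ k - t ^+ k) + (s - t) * t ^+ k); last by ring.
rewrite -natr1 [(_ + 1) * _]mulrDl mul1r (le_trans (ler_normD _ _)) // !normrM.
apply: lerD; first by apply: le_trans IH; rewrite ler_piMl // ger0_norm.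
by rewrite ler_piMr // ger0_norm ?exprn_ge0 // exprn_ile1.
Qed.

Lemma prod_roots_poly (s : seq C) :
  \prod_(z <- s) ('X - z%:P) = roots_poly (fun k : 'I_(size s) => s`_k).
Proof. by rewrite (big_nth 0) big_mkord. Qed.

Lemma monic_roots_poly (p : {poly C}) m : p \is monic -> size p = m.+1 ->
  exists v : 'I_m -> C, p = roots_poly v.
Proof.
move=> /monicP lp sp; have p0 : p != 0 by rewrite -size_poly_eq0 sp.
have <- : size (rootsC p) = m.
  by case: (size_rootsC p) => [|/eqP]; rewrite ?sp // (negPf p0).
exists (fun k => (rootsC p)`_k).
by rewrite -prod_roots_poly {1}(rootsC_prod p) lp scale1r.
Qed.

Lemma unit_diffop_K_F : unit_diffop n T -> deg_preserving n T /\ (K_F n T < +oo)%E.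
Proof.
case=> c c0 Tc; split; first by move=> f fn; rewrite Tc // size_diffop.
have [r r0 Hr] := diffop_root_near n n c0.
apply/sup_lty_bounded; exists (n%:R * (2 * r + 1) + r + 1).
  by have := ler0n R n; have := mulr_ge0 (ler0n R n) (ltW r0); lra.
move=> f [fn sf]; pose m := size (rootsC f).
have f0 : f != 0 by rewrite -size_poly_eq0; case: (size f) sf.
have sfm : size f = m.+1.
  case: (size_rootsC f) => [E|/eqP]; last by rewrite (negPf f0).
  by rewrite /m E prednK // size_poly_gt0.
have mn : (m <= n)%N by move: fn; rewrite /inPn sfm.
have d0 s : dilate c s 0%N = c 0%N by rewrite /dilate expr0 mul1r.
have d1 : diffop (dilate c 1) n f = T f.
  by rewrite Tc //; apply: eq_bigr => k _; rewrite /dilate expr1n mul1r.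
pose u (k : 'I_m) := (rootsC f)`_k.
(* The leading coefficient of the deformed image does not depend on [s], so one factor makes the
   whole path monic. *)
pose a := (c 0%N * lead_coef f)^-1.
have a0 : a != 0 by rewrite invr_neq0 // mulf_neq0 // lead_coef_eq0.
have aK : a * (c 0%N * lead_coef f) = 1.
  by rewrite mulVf // mulf_neq0 // lead_coef_eq0.
pose p s := a *: diffop (dilate c s) n f.
have p0E : p 0 = roots_poly u.
  by rewrite /p diffop_dilate0 scalerA {1}(rootsC_prod f) scalerA -mulrA aK scale1r prod_roots_poly.
have pv s : exists v : 'I_m -> C, p s = roots_poly v.
  apply: monic_roots_poly; last by rewrite size_scale // size_diffop ?d0.
  by rewrite monicE lead_coefZ lead_coef_diffop ?d0 // aK.
(* A Lipschitz constant in [s] for all coefficients, [s ^+ k] being [k]-Lipschitz on [0, 1]. It may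
   depend on [f], because the final bound does not involve it. *)
pose M : R := \sum_(k < n.+1) cnorm a * (k%:R * (cnorm (c k) * coef_norm f^`(k))).
have M0 : 0 <= M.
  apply: sumr_ge0 => k _; rewrite !mulr_ge0 ?cnorm_ge0 ?coef_norm_ge0 //.
have plip s t i : 0 <= s <= 1 -> 0 <= t <= 1 ->
    cnorm ((p s)`_i - (p t)`_i) <= M * `|s - t|.
  move=> s01 t01.
  have pE x : (p x)`_i = a * \sum_(k < n.+1) (x ^+ k)%:C%C * (c k * (f^`(k))`_i).
    rewrite /p coefZ coef_sum; congr (_ * _); apply: eq_bigr => k _.
    by rewrite coefZ /dilate -mulrA rmorphXn.
  rewrite (pE s) (pE t) -mulrBr -sumrB cnormM /M -mulr_sumr -[leRHS]mulrA.
  rewrite ler_wpM2l ?cnorm_ge0 // mulr_suml.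
  apply: le_trans (cnorm_sum _ _ _) _; apply: ler_sum => k _.
  have -> : (s ^+ k)%:C%C * (c k * (f^`(k))`_i) - (t ^+ k)%:C%C * (c k * (f^`(k))`_i) =
      (s ^+ k - t ^+ k)%:C%C * (c k * (f^`(k))`_i) by rewrite rmorphB mulrBl.
  rewrite cnormM (cnormM (c k)).
  have -> : cnorm (s ^+ k - t ^+ k)%:C%C = `|s ^+ k - t ^+ k|.
    have [h|h] := leP 0 (s ^+ k - t ^+ k); first by rewrite cnorm_real // ger0_norm.
    by rewrite -cnormN -rmorphN /= cnorm_real ?ltr0_norm // oppr_ge0 ltW.
  rewrite mulrAC ler_pM ?exprn_lipschitz ?mulr_ge0 ?cnorm_ge0 //.
  by rewrite ler_wpM2l ?cnorm_ge0 // le_coef_norm.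
have pnear s w : 0 <= s <= 1 -> root (p s) w -> exists k, cnorm (w - u k) <= r.
  move=> s01; rewrite rootZ // => /(Hr s f w s01 f0 fn)[x].
  rewrite -mem_rootsC // => /(nthP 0)[j jm <-] h.
  by exists (Ordinal jm).
have Tf0 : T f != 0 by rewrite Tc // diffop_eq0.
have sT : size (rootsC (T f)) = m.
  case: (size_rootsC (T f)) => [->|/eqP]; last by rewrite (negPf Tf0).
  by rewrite Tc // size_diffop // sfm.
have p1 : p 1 = roots_poly (fun k : 'I_m => (rootsC (T f))`_k).
  rewrite /p d1 {1}(rootsC_prod (T f)) scalerA Tc // lead_coef_diffop // -Tc // aK scale1r.
  by rewrite prod_roots_poly sT.
have [sg Hsg] := homotopy_matching (ltW r0) M0 p0E (fun s _ => pv s) plip pnear p1.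
apply/d_F_leP.
  by have := ler0n R n; have := mulr_ge0 (ler0n R n) (ltW r0); lra.
exists sg => k; apply: le_trans (Hsg k) _.
(* Replacing the degree [m] by [n] makes the bound uniform in [f]. *)
by rewrite !lerD2r ler_wpM2r ?ler_nat //; lra.
Qed.

End UnitDiffop.

(** * The cycle of implications *)

Theorem mainTheorem1 (R : realType) (n : nat) (T : {linear {poly R[i]} -> {poly R[i]}}) :
  (1 <= n)%N -> maps_Pn n T -> op_nonzero n T ->
  [<-> in_diff_span n T /\ op_invertible n T;
       grace_op n T;
       (K_h n T < +oo)%E;
       (K_m n T < +oo)%E;
       op_invertible n T /\ commutes_with_D n T;
       (K_H n T < +oo)%E;
       deg_preserving n T /\ (K_F n T < +oo)%E].
Proof.
move=> _ _ _.
have H_unit : (K_H n T < +oo)%E -> unit_diffop n T.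
  by move=> /K_H_K_h/K_h_K_m/K_m_unit_diffop.
tfae.
- by case=> sp inv; apply: unit_diffop_grace; apply: span_invertible_unit_diffop.
- exact: grace_K_h.
- exact: K_h_K_m.
- move=> /K_m_unit_diffop ud; split; first exact: unit_diffop_invertible.
  exact: unit_diffop_comm.
- case=> inv /comm_span sp.
  have [deg KF] := unit_diffop_K_F (span_invertible_unit_diffop sp inv).
  exact: K_F_K_H.
- by move=> /H_unit; apply: unit_diffop_K_F.
- case=> deg /(K_F_K_H deg)/H_unit ud; split; first exact: unit_diffop_span.
  exact: unit_diffop_invertible.
Qed.
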